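(* Any $C^2$-smooth generic submanifold $M\subset\mathbb{C}^n$ is $\Lambda_1$-pluriregular; that is, for every compact set $K\subset M$ there exist a constant $A=A_K>0$ and a neighborhood $O=O_K$ of $K$ in $\mathbb{C}^n$ such that $$V_M^*(z)\le A\, d(z,K)\qquad\text{for all } z\in O.$$
   Context: A real smooth submanifold $M\subset\mathbb{C}^n$ is called generic if for each $z\in M$ its real tangent space $T_zM$ satisfies $T_zM+J\,T_zM=\mathbb{C}^n$, where $J$ is the standard complex structure on $\mathbb{C}^n$ (multiplication by $i$). Such a submanifold has real dimension $m\ge n$. The Lelong class $\mathcal{L}(\mathbb{C}^n)$ is the class of plurisubharmonic functions $u$ on $\mathbb{C}^n$ with $\sup\{u(z)-\log^+|z| : z\in\mathbb{C}^n\}<+\infty$. For a subset $E\subset\mathbb{C}^n$, its pluricomplex Green function is $$V_E(z):=\sup\{u(z): u\in\mathcal{L}(\mathbb{C}^n),\ u|_E\le 0\},\qquad z\in\mathbb{C}^n,$$ and $V_E^*$ denotes its upper semicontinuous regularization. $d$ denotes the Euclidean distance in $\mathbb{C}^n$. For $\alpha>0$, a set $E$ is called $\Lambda_\alpha$-pluriregular if for every compact $K\subset E$ there exist a constant $A=A_K>0$ and a neighborhood $O=O_K$ of $K$ such that $V_E^*(z)\le A\,d^{\alpha}(z,K)$ for all $z\in O$. *)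

(* Defs.v *)
From HB Require Import structures.
From mathcomp Require Import all_boot all_order all_algebra.
From mathcomp Require Import all_classical all_reals all_analysis.
Set Implicit Arguments.
Unset Strict Implicit.
Unset Printing Implicit Defensive.
Import Order.TTheory GRing.Theory Num.Theory.
Import numFieldNormedType.Exports.
Local Open Scope classical_set_scope.
Local Open Scope ring_scope.

(* C^n is realized as the real vector space R^(n + n): the point x + i y, with
   x, y in R^n, is the row (x, y).  The topology and the differential calculus
   are those of 'rV[R]_(n + n); the library norm on row vectors is the sup
   norm, so the Euclidean norm is introduced separately. *)
Notation Cspace R n := 'rV[R]_(n + n).

(* i (x + i y) = - y + i x *)
Definition mulJ (R : realType) (n : nat) (z : Cspace R n) : Cspace R n :=
  row_mx (- rsubmx z) (lsubmx z).

Definition eucl_norm (R : realType) (N : nat) (x : 'rV[R]_N) : R :=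
  Num.sqrt (\sum_(i < N) x ord0 i ^+ 2).

(* As [inf set0 = 0], this is 0, and not +oo, when E is empty. *)
Definition eucl_dist (R : realType) (N : nat) (x : 'rV[R]_N) (E : set 'rV[R]_N) : R :=
  inf [set eucl_norm (x - y) | y in E].

(* Meant for open U. *)
Fixpoint Ck_on (R : realType) (V W : normedModType R) (k : nat) (U : set V)
    (f : V -> W) : Prop :=
  match k with
  | 0 => forall x, U x -> {for x, continuous f}
  | k'.+1 => (forall x, U x -> differentiable f x) /\
             (forall v : V, Ck_on k' U (fun x => 'D_v f x))
  end.

Definition Ck_diffeo (R : realType) (N k : nat) (U V : set 'rV[R]_N)
    (Phi Psi : 'rV[R]_N -> 'rV[R]_N) : Prop :=
  [/\ open U /\ open V, Phi @` U = V, (forall x, U x -> Psi (Phi x) = x),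
      Ck_on k U Phi & Ck_on k V Psi].

(* R^m x {0} inside R^N *)
Definition coord_slice (R : realType) (N m : nat) : set 'rV[R]_N :=
  [set x | forall i : 'I_N, (m <= i)%N -> x ord0 i = 0].

(* Embedded (not necessarily closed) submanifolds, through slice charts. *)
Definition Ck_submanifold (R : realType) (N k m : nat) (M : set 'rV[R]_N) : Prop :=
  (m <= N)%N /\
  forall p, M p -> exists (U V : set 'rV[R]_N) (Phi Psi : 'rV[R]_N -> 'rV[R]_N),
    [/\ U p, Ck_diffeo k U V Phi Psi &
        Phi @` (U `&` M) = V `&` @coord_slice R N m].

(* Velocities at p of curves drawn on M. *)
Definition tangent_space (R : realType) (N : nat) (M : set 'rV[R]_N)
    (p : 'rV[R]_N) : set 'rV[R]_N :=
  [set v | exists gamma : R -> 'rV[R]_N,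
    [/\ gamma 0 = p, (\forall t \near (0 : R), M (gamma t)) &
        is_derive (0 : R) (1 : R) gamma v]].

Definition is_generic (R : realType) (n : nat) (M : set (Cspace R n)) : Prop :=
  forall z, M z ->
    [set v + mulJ w | v in tangent_space M z & w in tangent_space M z] = setT.

Section pluripotential.
Local Open Scope ereal_scope.

(* Upper semicontinuous functions with values in [-oo, +oo[ satisfying
   u(a) <= (1 / 2 pi) \int_0^(2 pi) u(a + e^(i t) b) dt for all a, b; the
   function identically -oo is allowed.  The integral is meaningful because
   such a u is bounded above on circles. *)
Definition plurisubharmonic (R : realType) (n : nat)
    (u : Cspace R n -> \bar R) : Prop :=
  [/\ forall z, u z < +oo,
      lower_semicontinuous (fun z => - u z) &
      forall a b : Cspace R n,
        u a <= ((2 * pi)^-1)%R%:E *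
          \int[@lebesgue_measure R]_(t in `[0%R, (2 * pi)%R])
            u (a + cos t *: b + sin t *: mulJ b)%R].

(* [ln 0 = 0] in the library, so that log^+ 0 = 0. *)
Definition log_plus (R : realType) (x : R) : R := Num.max (ln x) 0%R.

Definition lelong (R : realType) (n : nat) (u : Cspace R n -> \bar R) : Prop :=
  plurisubharmonic u /\
  ereal_sup [set u z - (log_plus (eucl_norm z))%:E | z in setT] < +oo.

Definition green (R : realType) (n : nat) (E : set (Cspace R n))
    (z : Cspace R n) : \bar R :=
  ereal_sup [set u z | u in [set u : Cspace R n -> \bar R |
                             lelong u /\ forall w, E w -> u w <= 0]].

(* The neighborhoods of z contain z, so this is the least upper semicontinuous
   majorant of f. *)
Definition usc_reg (R : realType) (N : nat) (f : 'rV[R]_N -> \bar R)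
    (z : 'rV[R]_N) : \bar R := limf_esup f (nbhs z).

Definition Lambda_pluriregular (R : realType) (n : nat) (alpha : R)
    (E : set (Cspace R n)) : Prop :=
  forall K : set (Cspace R n), compact K -> K `<=` E ->
  exists (A : R) (O : set (Cspace R n)),
    [/\ (0 < A)%R, open O, K `<=` O &
        forall z, O z -> usc_reg (green E) z <= (A * eucl_dist z K `^ alpha)%R%:E].

End pluripotential.

(* Main.v *)
Require Import Defs.
From HB Require Import structures.
From mathcomp Require Import all_boot all_order all_algebra.
From mathcomp Require Import all_classical all_reals all_analysis.
From mathcomp Require Import ring lra.
Set Implicit Arguments.
Unset Strict Implicit.
Unset Printing Implicit Defensive.
Import Order.TTheory GRing.Theory Num.Theory.
Import numFieldNormedType.Exports.
Local Open Scope classical_set_scope.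
Local Open Scope ring_scope.

(** The proof compares the functions of the Lelong class with an explicit barrier.

    Let [rho] be a local defining function of [M], let [p] be a point of [M], and
    consider [psi w = `|rho w| - B * `|rho w| ^+ 2 + |w - p| ^ 2] on a small ball
    around [p].  At a point [z] outside [M], genericity gives a complex direction
    [v] along which, to first order, [rho] moves in the direction of [rho z] when
    [z] moves along [v] and does not move when [z] moves along [i v]
    ([local_defining_function]).  Along this complex line [`|rho|] is affine up to
    second order errors bounded by the C^2 norm of [rho], so for large [B] the
    term [- B * `|rho| ^+ 2] makes [psi] strictly superharmonic on the line
    ([barrier_supermean]).  A plurisubharmonic function cannot touch such a
    function from below ([psh_comparison]).  Hence if [u] is plurisubharmonic,
    [u <= 0] on [M] and [u <= c] on the ball, then [u] is at most a multiple of
    [c * psi]: this holds on [M], where [psi] is nonnegative, on the boundary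
    sphere, where the squared distance is bounded below, and therefore everywhere.
    As [psi] vanishes at [p] and is Lipschitz, [u z <= c * C * |z - p|]
    ([le_linear_of_bounded]).

    It remains to bound [c] independently of [u].  On a small concentric ball the
    last inequality gives [u <= c / 2], and for [u] in the Lelong class a bound on
    a small ball implies a bound on the large one with only an additive loss
    ([bernstein_walsh], obtained by the same comparison principle with a
    logarithmic barrier).  So [c] can be replaced by [c / 2 + b], and eventually
    by [2 * b + 1], with [b] depending on the geometry only
    ([uniform_local_estimate]).

    The estimate is uniform for [p] in a neighbourhood of each point of [M];
    compactness of [K] makes it uniform for [p] in [K] ([green_le_linear]), and
    the upper semicontinuous regularization preserves it because its right-hand
    side is continuous ([usc_reg_le_linear]). *)

(** * The sup norm and the complex structure *)

Section complex_structure.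
Context (R : realType) (n : nat).
Implicit Types b z : Cspace R n.

Lemma mulJ_is_linear : linear (@mulJ R n).
Proof.
by move=> a x y; rewrite /mulJ !linearP /= scale_row_mx add_row_mx.
Qed.

HB.instance Definition _ :=
  GRing.isLinear.Build R (Cspace R n) (Cspace R n) _ (@mulJ R n) mulJ_is_linear.

Lemma mulJK b : mulJ (mulJ b) = - b.
Proof. by rewrite /mulJ row_mxKr row_mxKl -[b in RHS]hsubmxK opp_row_mx. Qed.

Lemma rV_norm_le k (x : 'rV[R]_k) (c : R) : 0 <= c ->
  (forall i, `|x ord0 i| <= c) -> `|x| <= c.
Proof.
move=> c0 xc; rewrite /Num.Def.normr/= mx_normrE (bigmax_le _ c0)//= => -[i j] _.
by rewrite ord1.
Qed.

Lemma rV_coord_le k (x : 'rV[R]_k) i : `|x ord0 i| <= `|x|.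
Proof.
rewrite [leRHS]/Num.Def.normr/= mx_normrE.
exact: (le_bigmax _ (fun ij => `|x ij.1 ij.2|) (ord0, i)).
Qed.

Lemma mulJ_norm_le b : `|mulJ b| <= `|b|.
Proof.
apply: rV_norm_le => // i; rewrite /mulJ mxE.
by case: splitP => j _; rewrite !mxE ?normrN; exact: rV_coord_le.
Qed.

End complex_structure.

(** * Circular means of a plurisubharmonic function *)

(** Read off the definition of the integral by suprema of simple functions
    below [f], so that it applies to a plurisubharmonic [f] before anything is
    known about the measurability of [f]. *)
Lemma le_integral_pointwise d (T : measurableType d) (R : realType)
    (mu : {measure set T -> \bar R}) (D : set T) (f g : T -> \bar R) :
  (forall x, D x -> (f x <= g x)%E) ->
  (\int[mu]_(x in D) f x <= \int[mu]_(x in D) g x)%E.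
Proof.
move=> fg; rewrite /integral.
have fgD : {in setT, forall x, ((f \_ D) x <= (g \_ D) x)%E}.
  by move=> x _; rewrite /patch; case: ifPn => // /set_mem; exact: fg.
apply: leeB; apply: le_ereal_sup => _ [h /= hf <-]; exists h => //= x;
  apply: (le_trans (hf x)).
- by apply: (funepos_le fgD); rewrite in_setT.
- by apply: (funeneg_le fgD); rewrite in_setT.
Qed.

Section mean_value.
Context (R : realType) (n : nat).
Implicit Types (b z : Cspace R n) (u : Cspace R n -> \bar R).
Local Notation mu := (@lebesgue_measure R).

Definition circle_point z b (t : R) : Cspace R n :=
  z + cos t *: b + sin t *: mulJ b.

Lemma continuous_circle_point z b : continuous (circle_point z b).
Proof.
move=> t; apply: (@continuousD _ _ _ (fun t => z + cos t *: b)).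
  apply: continuousD; first exact: cst_continuous.
  by apply: continuousZr_tmp; exact: continuous_cos.
by apply: continuousZr_tmp; exact: continuous_sin.
Qed.

Lemma psh_le_mean u z b (g : R -> R) :
  plurisubharmonic u -> mu.-integrable `[0, 2 * pi] (EFin \o g) ->
  (forall t, (u (circle_point z b t) <= (g t)%:E)%E) ->
  (u z <= ((2 * pi)^-1 * \int[mu]_(t in `[0%R, (2 * pi)%R]) g t)%:E)%E.
Proof.
move=> [_ _ /(_ z b) mean] intg ug; apply: (le_trans mean).
rewrite EFinM lee_pmul2l//; last first.
  by rewrite lte_fin invr_gt0 mulr_gt0 ?pi_gt0.
rewrite /Rintegral fineK; first by apply: le_integral_pointwise => t _; exact: ug.
exact: integrable_fin_num.
Qed.

(** The point [(al + i be) b]; with [al ^+ 2 + be ^+ 2 = 1] it runs over the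
    circle of the complex line spanned by [b]. *)
Definition turn b (al be : R) : Cspace R n := al *: b + be *: mulJ b.

Lemma circle_pointE z b t : circle_point z b t = z + turn b (cos t) (sin t).
Proof. by rewrite /circle_point /turn addrA. Qed.

Lemma turnN b al be : turn (- b) al be = - turn b al be.
Proof. by rewrite /turn [mulJ (- b)]linearN !scalerN opprD. Qed.

Lemma turnJ b al be : turn (mulJ b) al be = mulJ (turn b al be).
Proof. by rewrite /turn linearD !linearZ. Qed.

Lemma mulJ_turn b al be : mulJ (turn b al be) = turn b (- be) al.
Proof.
by rewrite /turn [mulJ (_ + _)]linearD !linearZ /= mulJK scalerN scaleNr addrC.
Qed.

Lemma continuous_along_circle (psi : Cspace R n -> R) z b :
  (forall t, {for circle_point z b t, continuous psi}) ->
  mu.-integrable `[0, 2 * pi] (EFin \o (psi \o circle_point z b)).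
Proof.
move=> psic; apply: (@continuous_compact_integrable R (psi \o circle_point z b)).
  exact: segment_compact.
apply: continuous_subspaceT => t.
by apply: continuous_comp; [exact: continuous_circle_point|exact: psic].
Qed.

Lemma integrable_addR (f g : R -> R) :
  mu.-integrable `[0, 2 * pi] (EFin \o f) ->
  mu.-integrable `[0, 2 * pi] (EFin \o g) ->
  mu.-integrable `[0, 2 * pi] (EFin \o (fun t => f t + g t)).
Proof. by move=> intf intg; exact: (integrableD _ intf intg). Qed.

(** The circles with radii [b], [i b], [- b] and [- i b] are one circle entered at
    four different places, so summing the four mean inequalities bounds
    [4 * u z] by the integral of the sum of [psi] over the four quarter turns of
    [w].  This sum has no first order term in [w], nor terms of the type of
    [cos (2 t)] and [sin (2 t)], which is why a barrier can be tested pointwise,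
    with no trigonometric integral. *)
Lemma psh_no_strict_supermean u (psi : Cspace R n -> R) z b (c kappa : R) :
  plurisubharmonic u -> 0 < kappa -> u z = c%:E ->
  (forall al be : R, al ^+ 2 + be ^+ 2 = 1 -> let w := turn b al be in
    [/\ (u (z + w)%R <= (psi (z + w)%R)%:E)%E,
        {for z + w, continuous psi} &
        psi (z + w) + psi (z - w) + psi (z + mulJ w) + psi (z - mulJ w)
          <= 4 * c - kappa]) -> False.
Proof.
move=> pshu kappa0 uz H.
pose g (b' : Cspace R n) := psi \o circle_point z b'.
pose I b' := \int[mu]_(t in `[0%R, (2 * pi)%R]) g b' t.
have orb t : cos t ^+ 2 + sin t ^+ 2 = 1 :> R by rewrite cos2Dsin2.
(* The estimate is needed for the four vectors b' = b, - b, i b, - i b, whose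
   circles have the same points. *)
have mean b' : (forall t, exists al be : R,
    al ^+ 2 + be ^+ 2 = 1 /\ turn b' (cos t) (sin t) = turn b al be) ->
  mu.-integrable `[0, 2 * pi] (EFin \o g b') /\ c <= (2 * pi)^-1 * I b'.
  move=> b'b.
  have gint : mu.-integrable `[0, 2 * pi] (EFin \o g b').
    apply: continuous_along_circle => t; rewrite circle_pointE.
    by have [al [be [ab ->]]] := b'b t; case: (H _ _ ab).
  split=> //; rewrite -lee_fin -uz; apply: (psh_le_mean (b := b')) => // t.
  rewrite /g /= circle_pointE.
  by have [al [be [ab ->]]] := b'b t; case: (H _ _ ab).
have [i1 m1] := mean b (fun t => ex_intro _ _ (ex_intro _ _ (conj (orb t) erefl))).
have [i2 m2] : mu.-integrable `[0, 2 * pi] (EFin \o g (- b)) /\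
    c <= (2 * pi)^-1 * I (- b).
  apply: mean => t; exists (- cos t), (- sin t); rewrite !sqrrN orb; split=> //.
  by rewrite turnN /turn !scaleNr opprD.
have [i3 m3] : mu.-integrable `[0, 2 * pi] (EFin \o g (mulJ b)) /\
    c <= (2 * pi)^-1 * I (mulJ b).
  apply: mean => t; exists (- sin t), (cos t); rewrite sqrrN addrC orb; split=> //.
  by rewrite turnJ mulJ_turn.
have [i4 m4] : mu.-integrable `[0, 2 * pi] (EFin \o g (- mulJ b)) /\
    c <= (2 * pi)^-1 * I (- mulJ b).
  apply: mean => t; exists (sin t), (- cos t); rewrite sqrrN addrC orb; split=> //.
  by rewrite turnN turnJ mulJ_turn /turn opprD !scaleNr opprK.
have mI : measurable (`[0, 2 * pi]%classic : set (measurableTypeR R)) by [].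
have pi2 : 0 < 2 * pi :> R by rewrite mulr_gt0 ?pi_gt0.
suff : I b + I (- b) + I (mulJ b) + I (- mulJ b) <= (4 * c - kappa) * (2 * pi).
  have : 0 < kappa * (2 * pi) by rewrite mulr_gt0.
  move: m1; rewrite ler_pdivlMl//.
  move: m2; rewrite ler_pdivlMl//.
  move: m3; rewrite ler_pdivlMl//.
  move: m4; rewrite ler_pdivlMl// mulrBl.
  rewrite -[4 * c * _]mulrA [c * _]mulrC; move: (2 * pi * c) (kappa * _).
  by move: (I b) (I _) (I _) (I _); clear=> *; lra.
have D12 := integrable_addR i1 i2; have D123 := integrable_addR D12 i3.
have D1234 := integrable_addR D123 i4.
rewrite /I -!RintegralD//.
have -> : (4 * c - kappa) * (2 * pi) =
    \int[mu]_(t in `[0%R, (2 * pi)%R]) (cst (4 * c - kappa) t).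
  rewrite Rintegral_cst//= lebesgue_measure_itv /= lte_fin pi2.
  by rewrite -EFinD subr0.
apply: le_Rintegral => //.
  apply: (@continuous_compact_integrable R (cst (4 * c - kappa))).
    exact: segment_compact.
  by apply: continuous_subspaceT => t; exact: cst_continuous.
move=> t _; have [_ _] := H _ _ (orb t).
by rewrite /g /= !circle_pointE turnN turnJ turnN turnJ.
Qed.

End mean_value.

(** * Comparison with a barrier *)

Section maximum_principle.

Lemma ereal_between (R : realType) (x y : \bar R) :
  (x < y -> exists r : R, x < r%:E < y)%E.
Proof.
case: x y => [x||] [y||]//=.
- rewrite lte_fin => xy; exists ((x + y) / 2).
  by rewrite !lte_fin; apply/andP; split; lra.
- by move=> _; exists (x + 1); rewrite lte_fin ltry andbT; lra.
- by move=> _; exists (y - 1); rewrite lte_fin ltNyr; lra.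
- by move=> _; exists 0; rewrite ltNyr ltry.
Qed.

(** If the supremum [S] were not attained, then near each point [f] would stay
    below some real number [< S]; by compactness one such number would bound [f]
    on all of [K]. *)
Lemma compact_usc_max (R : realType) (X : topologicalType) (K : set X)
    (f : X -> \bar R) : compact K -> K !=set0 ->
  (forall x (a : R), K x -> (f x < a%:E)%E -> \forall y \near x, (f y < a%:E)%E) ->
  exists2 x, K x & forall y, K y -> (f y <= f x)%E.
Proof.
move=> /compact_near_coveringP cK [x0 Kx0] uscf.
pose S := ereal_sup (f @` K).
have fS y : K y -> (f y <= S)%E by move=> Ky; apply: ereal_sup_ubound; exists y.
have [[x [Kx fx]]|noS] := pselect (exists x, K x /\ f x = S).
  by exists x => // y Ky; rewrite fx; exact: fS.
have {}fS y : K y -> (f y < S)%E.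
  move=> Ky; rewrite lt_neqAle fS// andbT; apply/eqP => fyS.
  by apply: noS; exists y.
pose F := filter_from [set a : R | (a%:E < S)%E] (fun a => [set b | a <= b]).
have FF : Filter F.
  apply: filter_from_filter.
    by have [r /andP[_ rS]] := ereal_between (fS _ Kx0); exists r.
  move=> a b aS bS; exists (Num.max a b).
    by rewrite /= EFin_max gt_max aS bS.
  by move=> c /=; rewrite ge_max => /andP[].
have [a aS Ka] : \forall a \near F, K `<=` (fun y => f y < a%:E)%E.
  apply: cK => x Kx; have [r /andP[fr rS]] := ereal_between (fS _ Kx).
  exists ([set y | f y < r%:E]%E, [set b | r <= b]) => /=.
    by split; [exact: uscf|exists r].
  move=> [y b] /= [fy rb]; apply: (lt_le_trans fy).
  by rewrite lee_fin.
exfalso; move: aS; apply/negP; rewrite -leNgt.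
apply: ge_ereal_sup => _ [y Ky <-]; apply: ltW.
by apply: Ka Ky => /=.
Qed.

Context (R : realType) (n : nat).
Implicit Types (b z : Cspace R n) (u : Cspace R n -> \bar R).

Lemma psh_usc u z (a : R) : plurisubharmonic u -> (u z < a%:E)%E ->
  \forall w \near z, (u w < a%:E)%E.
Proof.
move=> [_ lsc _] uza.
have [|V zV Vu] := lsc z (- a); first by rewrite EFinN lteN2.
by apply: filterS zV => w /Vu; rewrite EFinN lteN2.
Qed.

(** Strict superharmonicity of [psi] at [z] along the complex line [z + C b], on
    the one circle of radius [b] that the comparison principle has to look at. *)
Definition strict_supermean (D : set (Cspace R n)) (psi : Cspace R n -> R) z :=
  exists b (kappa : R), 0 < kappa /\
    forall al be : R, al ^+ 2 + be ^+ 2 = 1 -> let w := turn b al be in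
    D (z + w) /\
    psi (z + w) + psi (z - w) + psi (z + mulJ w) + psi (z - mulJ w)
          <= 4 * psi z - kappa.

(** At a point [z] of [D] where [u - psi] is maximal and positive, [u] is at most
    [psi] plus a constant on [D], with equality at [z]; a strict supermean
    property of [psi] at [z] then contradicts the mean inequality of [u]. *)
Lemma psh_comparison u (psi : Cspace R n -> R) (D : set (Cspace R n)) :
  plurisubharmonic u -> compact D -> (forall z, D z -> {for z, continuous psi}) ->
  (forall z, D z -> (u z <= (psi z)%:E)%E \/ strict_supermean D psi z) ->
  forall z, D z -> (u z <= (psi z)%:E)%E.
Proof.
move=> pshu cD cpsi alt z0 Dz0; rewrite leNgt; apply/negP => uz0.
have [uy _ _] := pshu.
pose h z := (u z - (psi z)%:E)%E.
have [||z Dz hmax] := compact_usc_max (f := h) cD; first by exists z0.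
- move=> x a Dx; rewrite /h lteBlDr// -EFinD => uxa.
  have [r /andP[ur]] := ereal_between uxa; rewrite lte_fin => ra.
  have : \forall y \near x, `|psi x - psi y| < a + psi x - r.
    by move/cvgrPdist_lt : (cpsi _ Dx); apply; rewrite subr_gt0.
  apply: filterS2 (psh_usc pshu ur) => y uyr; rewrite ltr_norml => /andP[_ yr].
  rewrite lteBlDr// -EFinD; apply: (lt_trans uyr); rewrite lte_fin; lra.
have hz0 : (0 < h z0)%E by rewrite /h sube_gt0.
have hz : (0 < h z)%E by apply: (lt_le_trans hz0); exact: hmax.
have uzf : u z \is a fin_num.
  rewrite fin_numE -ltey uy andbT; apply/eqP => uz.
  by move: hz; rewrite /h uz.
have uzE : u z = (fine (u z))%:E by rewrite fineK.
have psiu : psi z < fine (u z) by move: hz; rewrite /h uzE sube_gt0 lte_fin.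
have [|[b [kappa [kappa0 H]]]] := alt _ Dz; first by rewrite uzE lee_fin leNgt psiu.
pose S := fine (u z) - psi z.
apply: (psh_no_strict_supermean (psi := fun w => psi w + S) (b := b) pshu kappa0 uzE).
move=> al be ab w; have [Dw sum] := H _ _ ab; split.
- have := hmax _ Dw; rewrite /h uzE -EFinB leeBlDr// -EFinD [_ - _ + _]addrC; exact.
- by apply: continuousD; [exact: cpsi|exact: cst_continuous].
- rewrite /S; move: sum; rewrite -/w; lra.
Qed.

End maximum_principle.

(** * The squared Euclidean norm *)

Section squared_norm.
Context (R : realType).

Definition sqnorm k (x : 'rV[R]_k) : R := \sum_i x ord0 i ^+ 2.
Definition dotr k (x y : 'rV[R]_k) : R := \sum_i x ord0 i * y ord0 i.

Lemma eucl_normE k (x : 'rV[R]_k) : eucl_norm x = Num.sqrt (sqnorm x).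
Proof. by []. Qed.

Lemma sqnorm_ge0 k (x : 'rV[R]_k) : 0 <= sqnorm x.
Proof. by apply: sumr_ge0 => i _; exact: sqr_ge0. Qed.

Lemma sqnormN k (x : 'rV[R]_k) : sqnorm (- x) = sqnorm x.
Proof. by apply: eq_bigr => i _; rewrite mxE sqrrN. Qed.

Lemma dotrr k (x : 'rV[R]_k) : dotr x x = sqnorm x.
Proof. by apply: eq_bigr => i _; rewrite expr2. Qed.

Lemma dotrDr k (x y z : 'rV[R]_k) : dotr x (y + z) = dotr x y + dotr x z.
Proof.
by rewrite /dotr -big_split; apply: eq_bigr => i _; rewrite mxE mulrDr.
Qed.

Lemma dotrZr k (a : R) (x y : 'rV[R]_k) : dotr x (a *: y) = a * dotr x y.
Proof. by rewrite /dotr mulr_sumr; apply: eq_bigr => i _; rewrite mxE mulrCA. Qed.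

Lemma dotrNr k (x y : 'rV[R]_k) : dotr x (- y) = - dotr x y.
Proof. by rewrite -scaleN1r dotrZr mulN1r. Qed.

Lemma sqnormD k (x y : 'rV[R]_k) :
  sqnorm (x + y) = sqnorm x + 2 * dotr x y + sqnorm y.
Proof.
rewrite /sqnorm /dotr mulr_sumr -!big_split; apply: eq_bigr => i _ /=.
by rewrite mxE; ring.
Qed.

Lemma sqnormZ k (a : R) (x : 'rV[R]_k) : sqnorm (a *: x) = a ^+ 2 * sqnorm x.
Proof. by rewrite /sqnorm mulr_sumr; apply: eq_bigr => i _; rewrite mxE exprMn. Qed.

Lemma sqnorm_le2 k (x y : 'rV[R]_k) :
  sqnorm x <= 2 * sqnorm y + 2 * sqnorm (x - y).
Proof.
rewrite /sqnorm !mulr_sumr -big_split; apply: ler_sum => i _ /=.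
rewrite !mxE -subr_ge0; set a := x _ _; set b := y _ _.
by rewrite (_ : _ - _ = (a - 2 * b) ^+ 2) ?sqr_ge0//; ring.
Qed.

Lemma norm_sqr_le_sqnorm k (x : 'rV[R]_k) : `|x| ^+ 2 <= sqnorm x.
Proof.
rewrite -[leRHS]sqr_sqrtr ?sqnorm_ge0// lerXn2r ?nnegrE ?sqrtr_ge0//.
apply: rV_norm_le; rewrite ?sqrtr_ge0// => i.
rewrite -sqrtr_sqr ler_sqrt ?sqnorm_ge0//.
by rewrite /sqnorm (bigD1 i)//= lerDl sumr_ge0// => j _; exact: sqr_ge0.
Qed.

Lemma norm_le_eucl_norm k (x : 'rV[R]_k) : `|x| <= eucl_norm x.
Proof.
rewrite eucl_normE -[leLHS]ger0_norm// -sqrtr_sqr ler_sqrt ?sqnorm_ge0//.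
exact: norm_sqr_le_sqnorm.
Qed.

Lemma sqnorm_le k (x : 'rV[R]_k) : sqnorm x <= k%:R * `|x| ^+ 2.
Proof.
have -> : k%:R * `|x| ^+ 2 = \sum_(i < k) `|x| ^+ 2.
  by rewrite sumr_const card_ord mulr_natl.
apply: ler_sum => i _.
by rewrite -real_normK ?num_real// lerXn2r ?nnegrE// rV_coord_le.
Qed.

Lemma continuous_sqnorm k : continuous (@sqnorm k).
Proof.
move=> x; apply: (@continuous_big _ _ +%R) => [|i _ {}x].
  exact: add_continuous.
have cx : {for x, continuous (fun y : 'rV[R]_k => y ord0 i)}.
  exact: coord_continuous.
by have := continuousM cx cx.
Qed.

Lemma continuous_sqnormB k (p : 'rV[R]_k) : continuous (fun w : 'rV[R]_k => sqnorm (w - p)).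
Proof.
move=> w; have cB : {for w, continuous (fun w : 'rV[R]_k => w - p)}.
  by apply: (@continuousB _ _ _ (fun w => w) (fun=> p)) => //; exact: cst_continuous.
exact: (continuous_comp cB (@continuous_sqnorm _ _)).
Qed.

Lemma sqnorm_mulJ n (b : Cspace R n) : sqnorm (mulJ b) = sqnorm b.
Proof.
rewrite /sqnorm !big_split_ord /= addrC; congr +%R; apply: eq_bigr => i _.
- by rewrite row_mxEr mxE.
- by rewrite row_mxEl !mxE sqrrN.
Qed.

Lemma dotr_mulJ n (b : Cspace R n) : dotr b (mulJ b) = 0.
Proof.
rewrite /dotr big_split_ord /= -big_split big1// => i _ /=.
by rewrite row_mxEr row_mxEl !mxE; ring.
Qed.

Lemma sqnorm_turn n (b : Cspace R n) (al be : R) :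
  sqnorm (turn b al be) = (al ^+ 2 + be ^+ 2) * sqnorm b.
Proof.
rewrite /turn sqnormD !sqnormZ dotrZr sqnorm_mulJ.
have -> : dotr (al *: b) (mulJ b) = al * dotr b (mulJ b).
  by rewrite /dotr mulr_sumr; apply: eq_bigr => i _; rewrite mxE mulrA.
by rewrite dotr_mulJ; ring.
Qed.

End squared_norm.

(** * A Bernstein-Walsh inequality *)

Section bernstein_walsh.
Context (R : realType) (n : nat).
Implicit Types (b z p : Cspace R n) (u : Cspace R n -> \bar R).

Lemma log_plus_sqrt (x : R) : 0 <= x -> log_plus (Num.sqrt x) <= ln (1 + x) / 2.
Proof.
move=> x0; rewrite /log_plus ge_max; apply/andP; split; last first.
  by rewrite divr_ge0// ln_ge0// lerDl.
have [->|xn0] := eqVneq x 0; first by rewrite sqrtr0 ln0// addr0 ln1 mul0r.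
have xp : 0 < x by rewrite lt_def xn0.
rewrite ler_pdivlMr// mulr_natr -lnXn ?sqrtr_gt0// sqr_sqrtr//.
by rewrite ler_ln ?posrE//; lra.
Qed.

(** The right-hand side replaces [log_plus] by a function with the same growth
    that is smooth at the unit sphere. *)
Lemma lelong_growth u : lelong u ->
  exists C : R, forall z, (u z <= (C + ln (1 + sqnorm z) / 2)%:E)%E.
Proof.
move=> [_ supu]; have [C /andP[uC _]] := ereal_between supu.
exists C => z; rewrite EFinD -leeBlDr//.
apply: le_trans (ltW uC); apply: le_trans; last first.
  by apply: ereal_sup_ubound; exists z.
apply: leeB => //; rewrite lee_fin eucl_normE log_plus_sqrt//.
exact: sqnorm_ge0.
Qed.

Lemma circle_factor_gt0 (tau x : R) : 0 < tau < 1 -> x ^+ 2 <= 1 ->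
  0 < 1 + 2 * (tau * x) + tau ^+ 2.
Proof.
move=> /andP[t0 t1] x1.
have x1' : -1 <= x <= 1 by rewrite -ler_norml -sqrtr_sqr -[leRHS]sqrtr1 ler_sqrt.
have -> : 1 + 2 * (tau * x) + tau ^+ 2 =
  (1 - tau) ^+ 2 + 2 * (tau * (1 + x)) by ring.
apply: ltr_pwDl; first by rewrite exprn_gt0// subr_gt0.
by rewrite mulr_ge0// mulr_ge0 ?(ltW t0)//; case/andP: x1'; lra.
Qed.

(** With [x = tau (al + i be)], the four terms are the [2 ln |1 + i^k x|] for
    [k < 4].  The product of the [1 + i^k x] is [1 - x ^ 4]: the harmonicity of
    the logarithm shows up as an error of order four only. *)
Lemma four_logs (tau al be : R) : 0 < tau < 1 -> al ^+ 2 + be ^+ 2 = 1 ->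
  ln (1 + 2 * (tau * al) + tau ^+ 2) + ln (1 - 2 * (tau * al) + tau ^+ 2)
  + ln (1 + 2 * (tau * be) + tau ^+ 2) + ln (1 - 2 * (tau * be) + tau ^+ 2)
  <= 4 * tau ^+ 4.
Proof.
move=> t01 ab; have [t0 t1] := andP t01.
have pos x := @circle_factor_gt0 tau x t01.
have a1 : al ^+ 2 <= 1 by rewrite -ab lerDl sqr_ge0.
have b1 : be ^+ 2 <= 1 by rewrite -ab lerDr sqr_ge0.
have p1 := pos _ a1; have p3 := pos _ b1.
have p2 : 0 < 1 - 2 * (tau * al) + tau ^+ 2.
  by have := pos (- al); rewrite sqrrN !mulrN => /(_ a1).
have p4 : 0 < 1 - 2 * (tau * be) + tau ^+ 2.
  by have := pos (- be); rewrite sqrrN !mulrN => /(_ b1).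
rewrite -!lnM ?posrE ?mulr_gt0//; set P := (X in ln X).
have P0 : 0 < P by rewrite !mulr_gt0.
have -> : P = 1 + (P - 1) by ring.
apply: le_trans (le_ln1Dx _) _; first by lra.
have -> : P = (1 - tau ^+ 4) ^+ 2 + 16 * tau ^+ 4 * (al ^+ 2 * be ^+ 2).
  rewrite /P; have -> : be ^+ 2 = 1 - al ^+ 2 by rewrite -ab; ring.
  have Eb : be ^+ 2 = 1 - al ^+ 2 by rewrite -ab; ring.
  transitivity (((1 + tau ^+ 2) ^+ 2 - 4 * tau ^+ 2 * al ^+ 2) *
    ((1 + tau ^+ 2) ^+ 2 - 4 * tau ^+ 2 * be ^+ 2)); first by ring.
  by rewrite Eb; ring.
have ab4 : 4 * (al ^+ 2 * be ^+ 2) <= 1.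
  have -> : be ^+ 2 = 1 - al ^+ 2 by rewrite -ab; ring.
  rewrite -subr_ge0 (_ : _ - _ = (1 - 2 * al ^+ 2) ^+ 2) ?sqr_ge0//; ring.
have t4 : 0 <= tau ^+ 4 <= 1.
  by rewrite exprn_ge0 ?(ltW t0)//= exprn_ile1 ?(ltW t0) ?(ltW t1).
have : tau ^+ 4 * (4 * (al ^+ 2 * be ^+ 2)) <= tau ^+ 4.
  by rewrite ler_piMr//; case/andP: t4.
have : (1 - tau ^+ 4) ^+ 2 <= 1 by rewrite exprn_ile1//; lra.
have -> : 16 * tau ^+ 4 * (al ^+ 2 * be ^+ 2) =
  4 * (tau ^+ 4 * (4 * (al ^+ 2 * be ^+ 2))) by ring.
move: ((1 - _) ^+ 2) (tau ^+ 4 * (4 * _)) => x y.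
by move: (tau ^+ 4); clear=> *; lra.
Qed.

(** On the complex line through [p] and [z] the function [ln Q] is harmonic and
    [- delta * Q] is strictly superharmonic: at scale [tau] the sum over quarter
    turns loses [4 * delta * Q z * tau ^+ 2], which beats the error
    [4 * tau ^+ 4] of the logarithms as soon as [tau ^+ 2 < delta]. *)
Lemma ln_barrier_supermean p (s T delta a : R) z :
  0 < s -> 0 < delta < 1 ->
  let Q w := sqnorm (w - p) / s ^+ 2 in
  1 < Q z < T ->
  strict_supermean [set w | 1 <= Q w <= T]
    (fun w => a + ln (Q w) - delta * (Q w - 1)) z.
Proof.
move=> s0 /andP[d0 d1] Q /andP[Q1 QT].
have Q0 : 0 < Q z by lra.
pose m := Num.min (T - Q z) (Q z - 1).
have m0 : 0 < m by rewrite lt_min; apply/andP; split; lra.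
have Q30 : 0 < 3 * Q z by lra.
pose tau := Num.min (delta / 2) (m / (3 * Q z)).
have t0 : 0 < tau by rewrite lt_min divr_gt0//= divr_gt0.
have td : tau <= delta / 2 by rewrite ge_min lexx.
have tm : 3 * tau * Q z <= m.
  rewrite -mulrA mulrCA -ler_pdivlMr//.
  by rewrite ge_min lexx orbT.
have tQ : 3 * tau * Q z <= T - Q z /\ 3 * tau * Q z <= Q z - 1.
  by split; apply: le_trans tm _; rewrite ge_min lexx ?orbT.
exists (tau *: (z - p)), (4 * (delta * Q z * tau ^+ 2 - tau ^+ 4)).
split.
  rewrite mulr_gt0// subr_gt0 (_ : 4 = 2 + 2)%N// exprD ltr_pM2r ?exprn_gt0//.
  have : tau ^+ 2 <= delta / 2 * 1.
    by rewrite expr2; apply: ler_pM; rewrite ?(ltW t0)//; lra.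
  have : delta * 1 <= delta * Q z by rewrite ler_pM2l// ltW.
  lra.
move=> al be ab w.
have Qw (v : Cspace R n) (ga : R) : sqnorm v = tau ^+ 2 * sqnorm (z - p) ->
    dotr (z - p) v = tau * ga * sqnorm (z - p) ->
    Q (z + v) = Q z * (1 + 2 * (tau * ga) + tau ^+ 2).
  move=> vv zv; rewrite /Q addrAC sqnormD vv zv; ring.
have Ew : w = turn (z - p) (tau * al) (tau * be).
  by rewrite /w /turn [mulJ (_ *: _)]linearZ !scalerA ![tau * _]mulrC.
have ww : sqnorm w = tau ^+ 2 * sqnorm (z - p).
  by rewrite Ew sqnorm_turn !exprMn -mulrDr ab mulr1.
have zw : dotr (z - p) w = tau * al * sqnorm (z - p).
  by rewrite Ew /turn dotrDr !dotrZr dotrr dotr_mulJ mulr0 addr0.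
have zJw : dotr (z - p) (mulJ w) = tau * (- be) * sqnorm (z - p).
  by rewrite Ew mulJ_turn /turn dotrDr !dotrZr dotrr dotr_mulJ mulr0 addr0 mulrN.
have al1 : -1 <= al <= 1.
  rewrite -ler_norml -sqrtr_sqr -[leRHS]sqrtr1 ler_sqrt//.
  by rewrite -ab lerDl sqr_ge0.
have tt : 0 <= tau ^+ 2 <= tau.
  by rewrite sqr_ge0 expr2 ler_piMl//; lra.
have ta : - tau <= tau * al <= tau.
  have : tau * -1 <= tau * al by rewrite ler_pM2l//; case/andP: al1.
  have : tau * al <= tau * 1 by rewrite ler_pM2l//; case/andP: al1.
  by rewrite mulr1 mulrN1 => -> ->.
have E1 := Qw w al ww zw.
have E2 : Q (z - w) = Q z * (1 - 2 * (tau * al) + tau ^+ 2).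
  rewrite (Qw (- w) (- al)) ?sqnormN// ?dotrNr ?zw; ring.
have E3 : Q (z + mulJ w) = Q z * (1 - 2 * (tau * be) + tau ^+ 2).
  rewrite (Qw (mulJ w) (- be)) ?sqnorm_mulJ//; ring.
have E4 : Q (z - mulJ w) = Q z * (1 + 2 * (tau * be) + tau ^+ 2).
  rewrite (Qw (- mulJ w) be) ?sqnormN ?sqnorm_mulJ// ?dotrNr ?zJw; ring.
clearbody Q; have t01 : 0 < tau < 1 by rewrite t0 /=; lra.
have := four_logs t01 ab.
have pos x := @circle_factor_gt0 tau x t01.
have a1 : al ^+ 2 <= 1 by rewrite -ab lerDl sqr_ge0.
have b1 : be ^+ 2 <= 1 by rewrite -ab lerDr sqr_ge0.
have p1 := pos _ a1; have p3 := pos _ b1.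
have p2 : 0 < 1 - 2 * (tau * al) + tau ^+ 2.
  by have := pos (- al); rewrite sqrrN !mulrN => /(_ a1).
have p4 : 0 < 1 - 2 * (tau * be) + tau ^+ 2.
  by have := pos (- be); rewrite sqrrN !mulrN => /(_ b1).
move=> logs; split.
  rewrite /= E1.
  have : Q z * (2 * (tau * al) + tau ^+ 2) <= Q z * (3 * tau).
    by rewrite ler_pM2l//; case/andP: tt; case/andP: ta; lra.
  have : Q z * - (3 * tau) <= Q z * (2 * (tau * al) + tau ^+ 2).
    by rewrite ler_pM2l//; case/andP: tt; case/andP: ta; lra.
  have -> : Q z * (1 + 2 * (tau * al) + tau ^+ 2) =
    Q z + Q z * (2 * (tau * al) + tau ^+ 2) by ring.
  rewrite mulrN [Q z * (3 * tau)]mulrC; case: tQ.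
  move: (Q z * (_ + _)) (3 * tau * Q z) => x y *.
  by apply/andP; split; lra.
rewrite E1 E2 E3 E4 !lnM ?posrE//.
move: logs; rewrite -subr_ge0 => logs; rewrite -subr_ge0.
by apply: le_trans logs _; rewrite le_eqVlt; apply/orP; left; apply/eqP; ring.
Qed.

(** Comparison of [u] with [a + ln Q - (Q - 1) / T] on the shell [1 <= Q <= T].
    Since [Q] is a squared distance, [ln Q] grows twice as fast as the members of
    the Lelong class, so this barrier dominates [u] where [Q = T] for [T]
    large. *)
Lemma bernstein_walsh u p (s a : R) : lelong u -> 0 < s ->
  (forall z, sqnorm (z - p) <= s ^+ 2 -> (u z <= a%:E)%E) ->
  forall z, s ^+ 2 <= sqnorm (z - p) ->
  (u z <= (a + ln (sqnorm (z - p) / s ^+ 2))%:E)%E.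
Proof.
move=> lu s0 ua z1 sz1; have [pshu _] := lu.
have s2 : 0 < s ^+ 2 by rewrite exprn_gt0.
have [C uC] := lelong_growth lu.
pose Q w := sqnorm (w - p) / s ^+ 2.
have Q1 : 1 <= Q z1 by rewrite /Q ler_pdivlMr// mul1r.
pose K := 1 + 2 * sqnorm p + 2 * s ^+ 2.
have K1 : 1 <= K.
  have := sqnorm_ge0 p; rewrite /K; lra.
(* T is large enough for z1 to lie in the shell, and for half of ln T to absorb
   the constants in the growth of u. *)
pose T := Num.max (Q z1 + 1) (expR (2 * (C - a + 1) + ln K)).
have T1 : Q z1 + 1 <= T by rewrite le_max lexx.
have lnT : 2 * (C - a + 1) + ln K <= ln T.
  rewrite -[leLHS]expRK ler_ln ?posrE ?expR_gt0//; last by lra.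
  by rewrite le_max lexx orbT.
have T0 : 1 < T by lra.
have T00 : 0 < T by lra.
pose psi w := a + ln (Q w) - T^-1 * (Q w - 1).
have cQ : continuous Q.
  move=> w; have := continuousM (@continuous_sqnormB _ _ p w)
    (@cst_continuous _ _ (s ^+ 2)^-1 w).
  by [].
pose D := [set w | 1 <= Q w <= T].
have cD : compact D.
  apply: bounded_closed_compact.
    exists (`|p| + (1 + T * s ^+ 2)); split; first exact: num_real.
    move=> M MT w /= /andP[_]; rewrite ler_pdivrMr// => wT.
    have wp : `|w - p| ^+ 2 <= T * s ^+ 2 by apply: le_trans (norm_sqr_le_sqnorm _) wT.
    have : 0 <= (`|w - p| - 1) ^+ 2 by exact: sqr_ge0.
    rewrite sqrrB1 => sq.
    have : 0 <= `|w - p| by [].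
    have : `|w| <= `|p| + `|w - p| by rewrite -[in leLHS](subrK p w) addrC ler_normD.
    by move: MT wp sq; rewrite -mulr_natl; move: (`|w - p| ^+ 2) => x; lra.
  have -> : D = Q @^-1` [set` `[1, T]].
    by rewrite /D; apply/seteqP; split => w /=; rewrite in_itv.
  by apply: closed_comp => [w _|]; [exact: cQ|exact: interval_closed].
have main : forall z, D z -> (u z <= (psi z)%:E)%E.
  apply: (psh_comparison pshu cD).
    move=> z /andP[Qz _]; have Qz0 : 0 < Q z by lra.
    have clnQ := continuous_comp (@cQ z) (continuous_ln Qz0).
    have ca := @cst_continuous _ _ a z; have c1 := @cst_continuous _ _ (1 : R) z.
    have cT := @cst_continuous _ _ T^-1 z.
    have := continuousB (continuousD ca clnQ) (continuousM cT (continuousB (@cQ z) c1)).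
    by [].
  move=> z Dz; have [Qz QzT] := andP Dz.
  have [QzE|Qzn1] := eqVneq (Q z) 1.
    left; rewrite /psi QzE ln1 subrr mulr0 subr0 addr0; apply: ua.
    by rewrite -[leRHS]mul1r -ler_pdivrMr// -/(Q z) QzE.
  have [QzE|QznT] := eqVneq (Q z) T.
    left; apply: le_trans (uC z) _; rewrite lee_fin /psi QzE.
    have : ln (1 + sqnorm z) <= ln K + ln T.
      rewrite -lnM ?posrE//; last by lra.
      have := sqnorm_ge0 z => z0.
      rewrite ler_ln ?posrE; [|by lra|by rewrite mulr_gt0//; lra].
      have := sqnorm_le2 z p.
      have -> : sqnorm (z - p) = T * s ^+ 2 by rewrite -QzE divfK// gt_eqF.
      rewrite /K; have := sqnorm_ge0 p => p0.
      have : (1 + 2 * sqnorm p) * 1 <= (1 + 2 * sqnorm p) * T.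
        by rewrite ler_pM2l; lra.
      lra.
    have : T^-1 * (T - 1) <= 1 by rewrite ler_pdivrMl// mulr1; lra.
    move: (T^-1 * _) (ln T) (ln K) lnT (ln (1 + _)) => *; lra.
  right; apply: ln_barrier_supermean => //.
    by rewrite invr_gt0 T00 invf_lt1.
  by rewrite lt_neqAle eq_sym Qzn1 Qz lt_neqAle QznT.
have Dz1 : D z1 by apply/andP; split; [exact: Q1|apply: le_trans T1; rewrite lerDl].
apply: le_trans (main z1 Dz1) _.
rewrite lee_fin /psi gerBl mulr_ge0 ?invr_ge0 ?(ltW T00)//.
by rewrite subr_ge0.
Qed.

End bernstein_walsh.

(** * Second order estimates for a map of class C^2 *)

Section calculus.
Context (R : realType).

Lemma is_derive_line (N k : nat) (f : 'rV[R]_N -> 'rV[R]_k) x w t i :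
  derivable f (x + t *: w) w ->
  is_derive t 1 (fun t => f (x + t *: w) ord0 i) (('D_w f (x + t *: w)) ord0 i).
Proof.
move=> df.
have quot : (fun h : R => h^-1 *: (((fun t => f (x + t *: w) ord0 i) \o shift t) (h *: 1)
     - f (x + t *: w) ord0 i)) =
    (fun h => h^-1 *: (((fun y => f y ord0 i) \o shift (x + t *: w)) (h *: w)
     - f (x + t *: w) ord0 i)).
  apply/funext => h /=; congr (_ *: (f _ _ _ - _)).
  by rewrite /shift/= scalerDl addrCA [h *: 1]mulr1.
split.
  by rewrite /derivable quot; exact: ((derivable_mxP _ _ _).1 df ord0 i).
by rewrite derive_mx// mxE /derive quot.
Qed.

(** The mean value theorem, applied to each coordinate; the free vector [d] makes
    it serve both as a Lipschitz bound ([d = 0]) and as a Taylor estimate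
    ([d] the derivative at [x]). *)
Lemma mean_value_rV (N k : nat) (f : 'rV[R]_N -> 'rV[R]_k) x w d (C : R) :
  0 <= C ->
  (forall t : R, 0 <= t <= 1 -> derivable f (x + t *: w) w) ->
  (forall t : R, 0 <= t <= 1 -> `|'D_w f (x + t *: w) - d| <= C) ->
  `|f (x + w) - f x - d| <= C.
Proof.
move=> C0 df dC; apply: rV_norm_le => // i.
pose g (t : R) := f (x + t *: w) ord0 i - t * d ord0 i.
pose dg (t : R) := ('D_w f (x + t *: w)) ord0 i - d ord0 i.
have gd (t : R) : 0 <= t <= 1 -> is_derive t 1 g (dg t).
  move=> t01; have H := is_derive_line i (df _ t01).
  have H2 : is_derive t 1 (fun t : R => t * d ord0 i) (d ord0 i).
    have := is_deriveM (@is_derive_id R R t 1) (@is_derive_cst R R R (d ord0 i) t 1).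
    by move/is_derive_eq; apply; rewrite scaler0 add0r [_ *: _]mulr1.
  exact: is_deriveB.
have [||c] := @MVT R g dg 0 1 ltr01.
- by move=> t; rewrite in_itv => /andP[? ?]; apply: gd; rewrite !ltW.
- apply: derivable_within_continuous => t; rewrite in_itv => t01.
  by have [] := gd t t01.
rewrite in_itv => /andP[c0 c1]; rewrite subr0 mulr1 /g scale1r scale0r addr0.
rewrite mul1r mul0r subr0 !mxE addrAC => ->.
apply: le_trans (dC c _); last by rewrite !ltW.
by rewrite /dg; have := rV_coord_le ('D_w f (x + c *: w) - d) i; rewrite !mxE.
Qed.

Lemma derive_coord_sum (N k : nat) (f : 'rV[R]_N -> 'rV[R]_k) x w :
  differentiable f x ->
  'D_w f x = \sum_j w ord0 j *: 'D_(delta_mx ord0 j) f x.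
Proof.
move=> df; rewrite deriveEjacobian// mulmx_sum_row; apply: eq_bigr => j _.
by rewrite deriveEjacobian// rowE.
Qed.

Lemma norm_coord_sum_le (N k : nat) (w : 'rV[R]_N) (a : 'I_N -> 'rV[R]_k) :
  `|\sum_j w ord0 j *: a j| <= (\sum_j `|a j|) * `|w|.
Proof.
apply: le_trans (ler_norm_sum _ _ _) _; rewrite mulr_suml.
apply: ler_sum => j _; rewrite normrZ mulrC ler_wpM2l//; exact: rV_coord_le.
Qed.

Lemma segment_in_ball (N : nat) (p x w : 'rV[R]_N) (r t : R) :
  `|x - p| < r -> `|x + w - p| < r -> 0 <= t <= 1 -> `|x + t *: w - p| < r.
Proof.
move=> xr yr /andP[t0 t1].
have -> : x + t *: w - p = (1 - t) *: (x - p) + t *: (x + w - p).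
  by rewrite scalerBl scale1r -[x + w - p]addrAC [t *: (_ + w)]scalerDr addrA
    subrK addrAC.
apply: le_lt_trans (ler_normD _ _) _; rewrite !normrZ.
rewrite (ger0_norm t0) ger0_norm ?subr_ge0//.
have [->|tn0] := eqVneq t 0; first by rewrite subr0 mul1r mul0r addr0.
have tp : 0 < t by rewrite lt_def tn0.
have -> : r = (1 - t) * r + t * r by rewrite -mulrDl subrK mul1r.
apply: ler_ltD; last by rewrite ltr_pM2l.
by rewrite ler_wpM2l ?subr_ge0// ltW.
Qed.

Lemma near_norm_ball (N : nat) (p : 'rV[R]_N) (P : set 'rV[R]_N) :
  (\forall x \near p, P x) ->
  exists2 r : R, 0 < r & forall x, `|x - p| < r -> P x.
Proof.
move=> /nbhs_ballP[r /= r0 rP]; exists r => // x xr; apply: rP.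
by rewrite -ball_normE /= distrC.
Qed.

(** The finitely many partial derivatives are bounded near [p] by continuity. *)
Lemma C1_locally_lipschitz (N k : nat) (U : set 'rV[R]_N)
    (f : 'rV[R]_N -> 'rV[R]_k) p :
  open U -> U p -> Ck_on 1 U f ->
  exists r L : R, [/\ 0 < r, 0 <= L, forall x, `|x - p| < r -> U x &
    forall x y, `|x - p| < r -> `|y - p| < r -> `|f y - f x| <= L * `|y - x|].
Proof.
move=> oU Up [df cf].
pose e j : 'rV[R]_N := delta_mx ord0 j.
pose c j := `|'D_(e j) f p| + 1.
have nc : \forall x \near p, forall j, `|'D_(e j) f x| < c j.
  apply: (@filter_forall _ _ (fun j => [set x | `|'D_(e j) f x| < c j]) (nbhs p) _) => j.
  have /cvg_norm/cvgrPdist_lt/(_ _ ltr01) := cf (e j) _ Up.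
  apply: filterS => x; rewrite ltr_norml => /andP[+ _].
  by rewrite ltrBrDr addrC ltrBlDr.
have nU : \forall x \near p, U x by exact: open_nbhs_nbhs.
have [r r0 Ur] := near_norm_ball (filterI nU nc); exists r, (\sum_j c j); split => //.
- by apply: sumr_ge0 => j _; rewrite addr_ge0.
- by move=> x /Ur[].
- move=> x y xr yr.
  have seg (t : R) : 0 <= t <= 1 -> `|x + t *: (y - x) - p| < r.
    by apply: segment_in_ball => //; rewrite [x + (y - x)]addrC subrK.
  have := @mean_value_rV N k f x (y - x) 0 ((\sum_j c j) * `|y - x|).
  rewrite [x + (y - x)]addrC subrK subr0; apply.
  + by rewrite mulr_ge0// sumr_ge0// => j _; rewrite addr_ge0.
  + by move=> t t01; apply: diff_derivable; apply: df; have [] := Ur _ (seg _ t01).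
  + move=> t t01; have [Ux cx] := Ur _ (seg _ t01).
    rewrite subr0 derive_coord_sum; last exact: df.
    apply: le_trans (norm_coord_sum_le _ _) _; apply: ler_wpM2r => //.
    by apply: ler_sum => j _; exact: ltW.
Qed.

Lemma Ck_onS (V W : normedModType R) (k : nat) (U : set V) (f : V -> W) :
  Ck_on k.+1 U f -> Ck_on k U f.
Proof.
elim: k f => [|k IH] f [df cf] /=.
  by move=> x /df; exact: differentiable_continuous.
by split=> // v; apply: IH; exact: cf.
Qed.

(** The partial derivatives of [f] are of class C^1, hence Lipschitz near [p];
    the second order remainder then comes from the mean value theorem. *)
Lemma C2_taylor (N k : nat) (U : set 'rV[R]_N) (f : 'rV[R]_N -> 'rV[R]_k) p :
  open U -> U p -> Ck_on 2 U f ->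
  exists r L : R, [/\ 0 < r /\ 0 <= L, forall x, `|x - p| < r -> U x,
    (forall x y, `|x - p| < r -> `|y - p| < r -> `|f y - f x| <= L * `|y - x|),
    (forall x y w, `|x - p| < r -> `|y - p| < r ->
      `|'D_w f y - 'D_w f x| <= L * `|y - x| * `|w|) &
    forall x w, `|x - p| < r -> `|x + w - p| < r ->
      `|f (x + w) - f x - 'D_w f x| <= L * `|w| ^+ 2].
Proof.
move=> oU Up f2; have f1 := Ck_onS f2; have [df cf] := f2.
have [r0 [L0 [r0p L0p r0U f_lip]]] := C1_locally_lipschitz oU Up f1.
pose e j : 'rV[R]_N := delta_mx ord0 j.
have /choice[rj /choice[Lj jP]] : forall j, exists r L : R, [/\ 0 < r, 0 <= L,
    forall x, `|x - p| < r -> U x &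
    forall x y, `|x - p| < r -> `|y - p| < r ->
      `|'D_(e j) f y - 'D_(e j) f x| <= L * `|y - x|].
  by move=> j; exact: (C1_locally_lipschitz oU Up (cf (e j))).
have nr (s : R) : 0 < s -> \forall x \near p, `|x - p| < s.
  move=> s0; apply/nbhs_ballP; exists s => // x.
  by rewrite -ball_normE /= distrC.
have nj : \forall x \near p, forall j, `|x - p| < rj j.
  apply: (@filter_forall _ _ (fun j => [set x | `|x - p| < rj j]) (nbhs p) _) => j.
  by apply: nr; have [] := jP j.
have [r rp rr] := near_norm_ball (filterI (nr _ r0p) nj).
have Df x y w : `|x - p| < r -> `|y - p| < r ->
    `|'D_w f y - 'D_w f x| <= (\sum_j Lj j) * `|y - x| * `|w|.
  move=> xr yr; have [xr0 xrj] := rr _ xr; have [yr0 yrj] := rr _ yr.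
  rewrite !derive_coord_sum; [|exact/df/r0U..].
  rewrite -sumrB; under eq_bigr do rewrite -scalerBr.
  apply: le_trans (norm_coord_sum_le _ _) _; apply: ler_wpM2r => //.
  rewrite mulr_suml; apply: ler_sum => j _.
  by have [_ _ _] := jP j; apply.
have Lj0 : 0 <= \sum_j Lj j by apply: sumr_ge0 => j _; have [] := jP j.
exists r, (L0 + \sum_j Lj j); split => //.
- by split=> //; rewrite addr_ge0.
- by move=> x /rr[xr0 _]; exact: r0U.
- move=> x y /rr[xr _] /rr[yr _]; apply: le_trans (f_lip _ _ xr yr) _.
  by rewrite ler_wpM2r// lerDl.
- move=> x y w xr yr; apply: le_trans (Df _ _ _ xr yr) _.
  by rewrite -!mulrA ler_wpM2r ?mulr_ge0// lerDr.
- move=> x w xr yr.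
  have seg (t : R) : 0 <= t <= 1 -> `|x + t *: w - p| < r.
    by move=> t01; exact: segment_in_ball.
  apply: mean_value_rV => [|t t01|t t01].
  + by rewrite mulr_ge0 ?sqr_ge0// addr_ge0.
  + by apply: diff_derivable; apply: df; apply: r0U; have [] := rr _ (seg _ t01).
  + apply: le_trans (Df _ _ _ xr (seg _ t01)) _.
    rewrite addrC addKr normrZ expr2 !mulrA; apply: ler_wpM2r => //.
    apply: ler_pM => //; first by rewrite mulr_ge0.
    have [t0 t1] := andP t01; rewrite (ger0_norm t0).
    apply: le_trans (_ : (\sum_j Lj j) * 1 <= _).
      by rewrite ler_wpM2l.
    by rewrite mulr1 lerDr.
Qed.

End calculus.

(** * Linear algebra of row vectors *)

Section linear_algebra.
Context (R : realType).

(** The hypothesis gives [`|x| <= 2 * `|x *m B|]: the matrix [B] is injective,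
    hence invertible, and its inverse has norm at most 2. *)
Lemma near_identity_solve k (B : 'M[R]_k) :
  (forall x : 'rV[R]_k, `|x *m B - x| <= `|x| / 2) ->
  forall y : 'rV[R]_k, exists2 x : 'rV[R]_k, x *m B = y & `|x| <= 2 * `|y|.
Proof.
move=> BI y.
have bnd (x : 'rV[R]_k) : `|x| <= 2 * `|x *m B|.
  have : `|x| <= `|x *m B| + `|x *m B - x|.
    by rewrite -[in leLHS](subKr (x *m B) x) ler_normB.
  by have := BI x; lra.
have Bu : B \in unitmx.
  rewrite -row_free_unit; apply: inj_row_free => x xB0; apply/eqP.
  by rewrite -normr_le0; apply: le_trans (bnd x) _; rewrite xB0 normr0 mulr0.
exists (y *m invmx B); first by rewrite mulmxKV.
by apply: le_trans (bnd _) _; rewrite mulmxKV.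
Qed.

Lemma mulmx_norm_le k l (V : 'M[R]_(k, l)) :
  exists2 K : R, 0 <= K & forall c : 'rV[R]_k, `|c *m V| <= K * `|c|.
Proof.
exists (\sum_j `|row j V|); first by apply: sumr_ge0.
by move=> c; rewrite mulmx_sum_row; exact: norm_coord_sum_le.
Qed.

Lemma row_mx_norm_le k l (c : 'rV[R]_k) (d : 'rV[R]_l) (e : R) :
  `|c| <= e -> `|d| <= e -> `|row_mx c d| <= e.
Proof.
move=> ce de; apply: rV_norm_le => [|i]; first exact: le_trans ce.
rewrite mxE; case: splitP => j _.
- exact: le_trans (rV_coord_le _ _) ce.
- exact: le_trans (rV_coord_le _ _) de.
Qed.

Lemma lsubmx_norm_le k l (x : 'rV[R]_(k + l)) : `|lsubmx x| <= `|x|.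
Proof. by apply: rV_norm_le => // i; rewrite mxE; exact: rV_coord_le. Qed.

Lemma rsubmx_norm_le k l (x : 'rV[R]_(k + l)) : `|rsubmx x| <= `|x|.
Proof. by apply: rV_norm_le => // i; rewrite mxE; exact: rV_coord_le. Qed.

(** The projection along the slice [R^m x {0}].  Composing a slice chart with it
    gives a defining function that takes values in the ambient space, whatever the
    codimension is. *)
Definition tail_proj N m : 'M[R]_N := diag_mx (\row_i (m <= i)%N%:R).

Lemma tail_projE N m (x : 'rV[R]_N) i :
  (x *m tail_proj N m) ord0 i = if (m <= i)%N then x ord0 i else 0.
Proof. by rewrite mul_mx_diag !mxE; case: (m <= i)%N; rewrite ?mulr1 ?mulr0. Qed.

Lemma tail_proj_idem N m (x : 'rV[R]_N) :
  x *m tail_proj N m *m tail_proj N m = x *m tail_proj N m.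
Proof. by apply/rowP => i; rewrite !tail_projE; case: (m <= i)%N. Qed.

Lemma tail_proj_norm N m (x : 'rV[R]_N) : `|x *m tail_proj N m| <= `|x|.
Proof.
apply: rV_norm_le => // i; rewrite tail_projE.
by case: ifP => _; [exact: rV_coord_le|rewrite normr0].
Qed.

Lemma tail_proj_eq0 N m (x : 'rV[R]_N) :
  (x *m tail_proj N m = 0) <-> @coord_slice R N m x.
Proof.
split=> [/rowP x0 i mi|x0].
  by have := x0 i; rewrite tail_projE mi mxE.
by apply/rowP => i; rewrite tail_projE mxE; case: ifP => // /x0.
Qed.

End linear_algebra.

(** * Slice charts *)

Section chart.
Context (R : realType) (N m : nat) (M U V : set 'rV[R]_N).
Context (Phi Psi : 'rV[R]_N -> 'rV[R]_N).
Context (diffeo : Ck_diffeo 2 U V Phi Psi).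
Context (slice : Phi @` (U `&` M) = V `&` @coord_slice R N m).

Lemma chart_slice z : U z -> (Phi z *m tail_proj R N m = 0 <-> M z).
Proof.
have [[oU oV] UV PsiK _ _] := diffeo.
move=> Uz; rewrite tail_proj_eq0; split=> [sz|Mz].
  have : (V `&` @coord_slice R N m) (Phi z).
    by split=> //; rewrite -UV; exists z.
  rewrite -slice => -[z' [Uz' Mz'] zz'].
  by rewrite -(PsiK _ Uz) -zz' PsiK.
have : (Phi @` (U `&` M)) (Phi z) by exists z.
by rewrite slice => -[].
Qed.

(** Along a curve drawn on [M] the last coordinates of [Phi] vanish identically. *)
Lemma chart_tangent p v : U p -> tangent_space M p v ->
  'D_v Phi p *m tail_proj R N m = 0.
Proof.
move=> Up [gamma [g0 gM dg]].
have [[oU oV] UV PsiK [dPhi _] _] := diffeo.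
have dg0 : differentiable gamma 0 by apply/derivable1_diffP; case: dg.
have dPg : differentiable Phi (gamma 0) by rewrite g0; exact: dPhi.
have dPhig : differentiable (Phi \o gamma) (0 : R) by exact: differentiable_comp.
have E : 'D_1 (Phi \o gamma) 0 = 'D_v Phi p.
  rewrite deriveE// diff_comp//= -[_ (1 : R)]deriveE// -deriveE//.
  by rewrite g0; case: dg => _ ->.
apply/tail_proj_eq0 => i mi; rewrite -E derive_mx; last exact: diff_derivable.
rewrite mxE.
have gU : \forall t \near (0 : R), U (gamma t).
  have : {for 0, continuous gamma} by exact: differentiable_continuous.
  by apply; rewrite g0; exact: open_nbhs_nbhs.
rewrite -[RHS](derive_cst (0 : R) (0 : R) (1 : R)).
apply: near_eq_derive.
near=> t.
have /tail_proj_eq0 -> // : Phi (gamma t) *m tail_proj R N m = 0.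
by apply/chart_slice; near: t.
Unshelve. all: by end_near. Qed.

(** [Phi \o Psi] is the identity near [Phi p], so the derivative of [Psi] gives a
    preimage. *)
Lemma chart_derivative_onto p e : U p -> exists w, 'D_w Phi p = e.
Proof.
have [[oU oV] UV PsiK [dPhi _] [dPsi _]] := diffeo.
move=> Up; have Vp : V (Phi p) by rewrite -UV; exists p.
have dPsip := dPsi _ Vp.
have dPP : differentiable Phi (Psi (Phi p)) by rewrite PsiK//; exact: dPhi.
exists ('D_e Psi (Phi p)).
have -> : 'D_('D_e Psi (Phi p)) Phi p = 'D_e (Phi \o Psi) (Phi p).
  rewrite [RHS]deriveE; last exact: differentiable_comp.
  by rewrite diff_comp//= -!deriveE// PsiK.
rewrite -[RHS](@derive_val _ _ _ _ _ _ _ (is_derive_id (Phi p) e)).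
apply: near_eq_derive.
have : \forall y \near Phi p, V y by exact: open_nbhs_nbhs.
apply: filterS => y Vy; have : (Phi @` U) y by rewrite UV.
by move=> [x Ux <-] /=; rewrite PsiK.
Qed.

End chart.

(** * Local defining functions of a generic submanifold *)

Section defining_function.
Context (R : realType) (n m : nat) (M : set (Cspace R n)).
Local Notation N := (n + n).

(** Besides being Lipschitz with zero set [M], the defining function [rho] has at
    each point [z] near [p] a complex direction [v], of size comparable to
    [rho z], along which [rho] is [(1 + s) *: rho z] up to second order: the
    derivative of [rho] at [z] sends [v] to [rho z] and [i v] to [0].

    At [p] this is what genericity says.  Each value [e] of the derivative is
    attained at some [w = a + i b] with [a] and [b] tangent; as the derivative
    kills [a] and [b], it sends [i b] to [e] and [i (i b) = - b] to [0].  At a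
    nearby point [z] the two linear equations for [v] are solved by perturbation.
    They have to hold exactly: with an approximate solution [rho] would get
    a first order term transverse to [rho z], whose effect on [`|rho|] is not
    controlled as [rho z] tends to [0]. *)
Lemma local_defining_function p :
  Ck_submanifold 2 m M -> is_generic M -> M p ->
  exists (rho : Cspace R n -> 'rV[R]_N) (r L : R),
  [/\ 0 < r /\ 0 <= L,
      forall z, `|z - p| < r -> {for z, continuous rho},
      forall z, `|z - p| < r -> (rho z = 0 <-> M z),
      forall x y, `|x - p| < r -> `|y - p| < r -> `|rho y - rho x| <= L * `|y - x| &
      forall z, `|z - p| < r -> exists2 v : Cspace R n, `|v| <= L * `|rho z| &
        forall s t : R, let w := s *: v + t *: mulJ v in `|z + w - p| < r ->
        `|rho (z + w) - (1 + s) *: rho z| <= L * (s ^+ 2 + t ^+ 2) * `|rho z| ^+ 2].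
Proof.
move=> [_ charts] gen Mp.
have [U [V [Phi [Psi [Up dif sl]]]]] := charts _ Mp.
have [[oU oV] UV PsiK CPhi CPsi] := dif; have [dPhi _] := CPhi.
have [r [L [[r0 L0] rU lip Dlip taylor]]] := C2_taylor oU Up CPhi.
pose Pm := tail_proj R N m.
pose rho z := Phi z *m Pm.
have PmK : Pm *m Pm = Pm.
  by apply/row_matrixP => i; rewrite !rowE mulmxA tail_proj_idem.
have [A [DA APm]] : exists A : Cspace R n -> 'M[R]_N,
    (forall z w, U z -> 'D_w Phi z *m Pm = w *m A z) /\
    (forall z, A z *m Pm = A z).
  exists (fun z => jacobian Phi z *m Pm); split=> [z w Uz|z].
    by rewrite deriveEjacobian ?mulmxA//; exact: dPhi.
  by rewrite -mulmxA PmK.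
(* Genericity produces v0 j, sent to the projection of the j-th basis vector,
   while i (v0 j) is sent to 0. *)
have /choice[v0 v0P] : forall j : 'I_N, exists v : Cspace R n,
    v *m A p = delta_mx ord0 j *m Pm /\ mulJ v *m A p = 0.
  move=> j; have [w wE] := chart_derivative_onto dif (delta_mx ord0 j) Up.
  have : [set v + mulJ w | v in tangent_space M p & w in tangent_space M p] w.
    by rewrite gen.
  move=> [a ta [b tb abw]]; exists (mulJ b).
  have Aa : a *m A p = 0 by rewrite -(DA _ _ Up); exact: (chart_tangent dif sl).
  have Ab : b *m A p = 0 by rewrite -(DA _ _ Up); exact: (chart_tangent dif sl).
  split; last by rewrite mulJK mulNmx Ab oppr0.
  have -> : mulJ b = w - a by rewrite -abw addrAC subrr add0r.
  by rewrite mulmxBl Aa subr0 -(DA _ _ Up) wE.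
pose W : 'M[R]_N := \matrix_j v0 j.
pose Jm : 'M[R]_N := lin1_mx (@mulJ R n).
have mulJE v : mulJ v = v *m Jm by rewrite mul_rV_lin1.
have WA : W *m A p = Pm.
  apply/row_matrixP => i; rewrite row_mul rowK.
  by have [-> _] := v0P i; rewrite [RHS]rowE.
have WJA : W *m Jm *m A p = 0.
  apply/row_matrixP => i; rewrite !row_mul rowK -mulJE.
  by have [_ ->] := v0P i; rewrite row0.
have [K K0 WK] := mulmx_norm_le W.
pose delta := (4 * K * L + 1)^-1.
have KL0 : 0 <= K * L by rewrite mulr_ge0.
have d0 : 0 < delta by rewrite invr_gt0; lra.
have dKL : 4 * K * L * delta <= 1 by rewrite ler_pdivrMr; lra.
exists rho, (Num.min r delta), (L + 4 * K + 32 * K ^+ 2 * L).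
have inr z : `|z - p| < Num.min r delta -> `|z - p| < r.
  by rewrite lt_min => /andP[].
have KKL : 0 <= 32 * K ^+ 2 * L by rewrite !mulr_ge0// exprn_ge0.
have rhoB x y : rho y - rho x = (Phi y - Phi x) *m Pm by rewrite mulmxBl.
split.
- by split; [rewrite lt_min r0|rewrite !addr_ge0//; lra].
- move=> z /inr zr; have Pc : {for z, continuous Phi}.
    by apply: differentiable_continuous; apply: dPhi; exact: rU.
  apply/(@cvgrPdist_le _ _ _ (nbhs z) (nbhs_filter z)) => e e0.
  have H : \forall y \near z, `|Phi z - Phi y| <= e.
    by move/cvgrPdist_le : Pc; exact.
  apply: (@filterS _ (nbhs z) _ _ _ _ H) => y; apply: le_trans.
  rewrite rhoB; exact: tail_proj_norm.
- by move=> z /inr zr; apply: (chart_slice dif sl); exact: rU.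
- move=> x y /inr xr /inr yr; rewrite rhoB; apply: le_trans (tail_proj_norm _ _) _.
  apply: le_trans (lip _ _ xr yr) _; rewrite ler_wpM2r//; lra.
move=> z zrd; have zr := inr _ zrd; have Uz := rU _ zr.
have zd : `|z - p| <= delta by move: zrd; rewrite lt_min => /andP[_ /ltW].
pose X := W *m A z + (1%:M - Pm); pose Y := W *m Jm *m A z.
have Ddiff (w : 'rV[R]_N) : `|w *m A z - w *m A p| <= L * delta * `|w|.
  have -> : w *m A z - w *m A p = ('D_w Phi z - 'D_w Phi p) *m Pm.
    by rewrite mulmxBl (DA _ _ Uz) (DA _ _ Up).
  apply: le_trans (tail_proj_norm _ _) _; apply: le_trans (Dlip _ _ _ _ zr) _.
    by rewrite subrr normr0.
  by rewrite ler_wpM2r// ler_wpM2l.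
(* Unknowns (c, d), with v = c W - i (d W).  The block matrix of X and Y is the
   system for (c, d), completed by the identity on the kernel of the projection
   so as to become invertible. *)
have cX (c : 'rV[R]_N) : `|c *m X - c| <= L * delta * K * `|c|.
  have -> : c *m X - c = c *m W *m A z - c *m W *m A p.
    rewrite -[c *m W *m A p]mulmxA WA /X mulmxDr mulmxBr mulmx1 mulmxA.
    by rewrite addrA addrAC addrK.
  apply: le_trans (Ddiff _) _; rewrite -[leRHS]mulrA.
  by rewrite ler_wpM2l// mulr_ge0// ltW.
have cY (c : 'rV[R]_N) : `|c *m Y| <= L * delta * K * `|c|.
  have -> : c *m Y = c *m W *m Jm *m A z - c *m W *m Jm *m A p.
    have -> : c *m W *m Jm *m A p = 0.
      by rewrite -[c *m W *m Jm]mulmxA -mulmxA WJA mulmx0.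
    by rewrite subr0 /Y !mulmxA.
  apply: le_trans (Ddiff _) _; rewrite -[leRHS]mulrA.
  rewrite ler_wpM2l ?mulr_ge0 ?(ltW d0)//.
  by rewrite -mulJE; apply: le_trans (mulJ_norm_le _) (WK c).
have XPm : X *m Pm = W *m A z.
  by rewrite /X mulmxDl mulmxBl mul1mx PmK subrr addr0 -[LHS]mulmxA APm.
have YPm : Y *m Pm = W *m Jm *m A z by rewrite /Y -[LHS]mulmxA APm.
clearbody X Y.
have [x xB xn] : exists2 x : 'rV[R]_(N + N),
    x *m block_mx X Y (- Y) X = row_mx (rho z) 0 &
    `|x| <= 2 * `|row_mx (rho z) (0 : 'rV[R]_N)|.
  apply: near_identity_solve => x.
  have LdK : L * delta * K * `|x| + L * delta * K * `|x| <= `|x| / 2.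
    have -> : L * delta * K * `|x| + L * delta * K * `|x| =
      (4 * K * L * delta) * (`|x| / 2) by field.
    by rewrite ler_piMl// divr_ge0.
  have LdK0 : 0 <= L * delta * K by rewrite !mulr_ge0// ltW.
  have [c [d [xE [cn dn]]]] : exists c d : 'rV[R]_N,
      x = row_mx c d /\ `|c| <= `|x| /\ `|d| <= `|x|.
    exists (lsubmx x), (rsubmx x).
    by rewrite hsubmxK lsubmx_norm_le rsubmx_norm_le.
  have bound (e : 'rV[R]_N) : `|e| <= `|x| ->
      L * delta * K * `|e| <= L * delta * K * `|x|.
    by move=> ex; rewrite ler_wpM2l.
  apply: le_trans LdK; rewrite [in leLHS]xE mul_row_block opp_row_mx add_row_mx.
  rewrite mulmxN addrAC -[c *m Y + _ - d]addrA.
  apply: row_mx_norm_le.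
  - apply: le_trans (ler_normB _ _) _; apply: lerD.
      exact: le_trans (cX c) (bound _ cn).
    exact: le_trans (cY d) (bound _ dn).
  - apply: le_trans (ler_normD _ _) _; apply: lerD.
      exact: le_trans (cY c) (bound _ cn).
    exact: le_trans (cX d) (bound _ dn).
pose c := lsubmx x; pose d := rsubmx x.
have [E1 E2] : c *m X - d *m Y = rho z /\ c *m Y + d *m X = 0.
  move: xB; rewrite -[x in x *m _]hsubmxK mul_row_block mulmxN => /eq_row_mx.
  by [].
have F1 : c *m W *m A z - d *m W *m Jm *m A z = rho z.
  have <- : rho z *m Pm = rho z by rewrite tail_proj_idem.
  by rewrite -E1 mulmxBl -![_ *m _ *m Pm]mulmxA XPm YPm !mulmxA.
have F2 : c *m W *m Jm *m A z + d *m W *m A z = 0.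
  have <- : (0 : 'rV[R]_N) *m Pm = 0 by rewrite mul0mx.
  by rewrite -E2 mulmxDl -![_ *m _ *m Pm]mulmxA XPm YPm !mulmxA.
pose v : Cspace R n := c *m W - mulJ (d *m W).
have Av : v *m A z = rho z by rewrite mulmxBl mulJE.
have AJv : mulJ v *m A z = 0.
  by rewrite [mulJ v]linearB /= mulJK opprK mulmxDl mulJE.
have vn : `|v| <= 4 * K * `|rho z|.
  have xr : `|x| <= 2 * `|rho z|.
    apply: le_trans xn _; rewrite ler_wpM2l//.
    by apply: row_mx_norm_le => //; rewrite normr0.
  have : `|c *m W| <= K * (2 * `|rho z|).
    apply: le_trans (WK _) _; rewrite ler_wpM2l//.
    by apply: le_trans xr; exact: lsubmx_norm_le.
  have : `|mulJ (d *m W)| <= K * (2 * `|rho z|).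
    apply: le_trans (mulJ_norm_le _) _; apply: le_trans (WK _) _.
    rewrite ler_wpM2l//; apply: le_trans xr; exact: rsubmx_norm_le.
  have := ler_normB (c *m W) (mulJ (d *m W)); rewrite -/v.
  have -> : 4 * K * `|rho z| = K * (2 * `|rho z|) + K * (2 * `|rho z|) by ring.
  by move: (K * (2 * _)) (`|_|) (`|_|) (`|v|) => *; lra.
exists v.
  by apply: le_trans vn _; rewrite ler_wpM2r//; lra.
move=> s t w /inr zwr.
have wn : `|w| <= (`|s| + `|t|) * (4 * K * `|rho z|).
  apply: le_trans (ler_normD _ _) _; rewrite !normrZ mulrDl; apply: lerD.
    by rewrite ler_wpM2l.
  by rewrite ler_wpM2l//; apply: le_trans (mulJ_norm_le _) vn.
have Aw : w *m A z = s *: rho z.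
  by rewrite mulmxDl -!scalemxAl Av AJv scaler0 addr0.
have -> : rho (z + w) - (1 + s) *: rho z = (Phi (z + w) - Phi z - 'D_w Phi z) *m Pm.
  by rewrite !mulmxBl (DA _ _ Uz) Aw scalerDl scale1r opprD addrA.
apply: le_trans (tail_proj_norm _ _) _; apply: le_trans (taylor _ _ zr zwr) _.
have w2 : `|w| ^+ 2 <= (`|s| + `|t|) ^+ 2 * (4 * K * `|rho z|) ^+ 2.
  by rewrite -exprMn lerXn2r ?nnegrE// (le_trans _ wn).
have st : (`|s| + `|t|) ^+ 2 <= 2 * (s ^+ 2 + t ^+ 2).
  rewrite -(real_normK (num_real s)) -(real_normK (num_real t)) -subr_ge0.
  by rewrite (_ : _ - _ = (`|s| - `|t|) ^+ 2) ?sqr_ge0//; ring.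
apply: le_trans (_ : (32 * K ^+ 2 * L) * ((s ^+ 2 + t ^+ 2) * `|rho z| ^+ 2) <= _).
  have -> : 32 * K ^+ 2 * L * ((s ^+ 2 + t ^+ 2) * `|rho z| ^+ 2) =
    L * (2 * (s ^+ 2 + t ^+ 2) * (4 * K * `|rho z|) ^+ 2) by ring.
  rewrite ler_wpM2l//; apply: le_trans w2 _.
  by rewrite ler_wpM2r// sqr_ge0.
rewrite -[leRHS]mulrA ler_wpM2r ?mulr_ge0 ?addr_ge0 ?sqr_ge0//; lra.
Qed.

End defining_function.

(** * The barrier *)

Section barrier.
Context (R : realType) (n : nat).
Implicit Types (p z w v : Cspace R n) (u : Cspace R n -> \bar R).
Local Notation N := (n + n).

(** Put [d = `|rho z|] and move from [z] by [tau (al v + be i v)].  Up to an error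
    of order [tau ^+ 2 * d ^+ 2], the norm of [rho] becomes [d * (1 + tau * al)].
    The first term of the barrier is thus affine in [al]; the second one,
    [- B * `|rho| ^+ 2], is strictly concave in [al] and its mean drops by
    a multiple of [B * tau ^+ 2 * d ^+ 2].  The coefficient [B] is chosen so that
    this drop beats the error term, of size [L], and the contribution of the
    squared distance, of size [N%:R * L ^+ 2]. The condition on
    [4 * B * `|rho z|] keeps [x - B * x ^+ 2] increasing on the range of
    [`|rho|]. *)
Lemma barrier_supermean (rho : Cspace R n -> 'rV[R]_N) (L B r : R) p z v :
  0 <= L -> 2 * L + 2 * (N%:R * L ^+ 2) + 1 <= B ->
  0 < `|rho z| -> 4 * B * `|rho z| <= 1 -> `|z - p| < r ->
  `|v| <= L * `|rho z| ->
  (forall s t : R, let w := s *: v + t *: mulJ v in `|z + w - p| <= r ->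
    `|rho (z + w) - (1 + s) *: rho z| <= L * (s ^+ 2 + t ^+ 2) * `|rho z| ^+ 2) ->
  strict_supermean [set w | `|w - p| <= r]
    (fun w => `|rho w| - B * `|rho w| ^+ 2 + sqnorm (w - p)) z.
Proof.
move=> L0 LB; set d := `|rho z| => d0 Bd zr vd est.
pose C2 := N%:R * L ^+ 2.
have C20 : 0 <= C2 by rewrite mulr_ge0// sqr_ge0.
have B0 : 0 < B by rewrite /C2 in C20; lra.
pose tau := Num.min (1 / 2) ((r - `|z - p|) / (2 * `|v| + 1)).
have v1 : 0 < 2 * `|v| + 1 by have : 0 <= `|v| by []; lra.
have t0 : 0 < tau by rewrite lt_min; apply/andP; split; [lra|rewrite divr_gt0// subr_gt0].
have t2 : tau <= 1 / 2 by rewrite ge_min lexx.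
have tv : 2 * tau * `|v| <= r - `|z - p|.
  have : tau * (2 * `|v| + 1) <= r - `|z - p|.
    by rewrite -ler_pdivlMr// ge_min lexx orbT.
  by move: (`|v|) (`|z - p|) t0 => *; lra.
exists (tau *: v), (2 * (tau ^+ 2 * d ^+ 2)); split.
  by rewrite mulr_gt0// mulr_gt0// exprn_gt0.
have Ld : 8 * (L * d) <= 1.
  have : 2 * L * d <= B * d by rewrite ler_pM2r//; rewrite /C2 in C20; lra.
  by move: Bd; rewrite -!mulrA; move: (B * d) (L * d) => *; lra.
(* Monotonicity of x - B x^2 allows to replace the norm of rho by its upper bound
   Y, and then to drop the positive error term inside the square. *)
have pt s t : s ^+ 2 + t ^+ 2 = tau ^+ 2 -> let w := s *: v + t *: mulJ v in
    `|z + w - p| <= r /\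
    `|rho (z + w)| - B * `|rho (z + w)| ^+ 2 <=
      d * (1 + s) + L * tau ^+ 2 * d ^+ 2 - B * (d * (1 + s)) ^+ 2.
  move=> st w.
  have sle : `|s| <= tau.
    rewrite -(ger0_norm (ltW t0)) -!sqrtr_sqr ler_sqrt ?sqr_ge0//.
    by rewrite -st lerDl sqr_ge0.
  have tle : `|t| <= tau.
    rewrite -(ger0_norm (ltW t0)) -!sqrtr_sqr ler_sqrt ?sqr_ge0//.
    by rewrite -st lerDr sqr_ge0.
  have wr : `|z + w - p| <= r.
    rewrite addrAC; apply: le_trans (ler_normD _ _) _.
    have : `|w| <= tau * `|v| + tau * `|v|.
      apply: le_trans (ler_normD _ _) _; rewrite !normrZ; apply: lerD.
        by rewrite ler_wpM2r.
      by apply: ler_pM => //; exact: mulJ_norm_le.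
    by move: tv; rewrite -mulrA; move: (tau * _) (`|w|) (`|z - p|) => *; lra.
  split=> //.
  have s1 : 0 <= 1 + s by move: sle; rewrite ler_norml => /andP[]; lra.
  pose Y := d * (1 + s) + L * tau ^+ 2 * d ^+ 2.
  have XY : `|rho (z + w)| <= Y.
    have := est s t wr; rewrite st -/w => E.
    have : `|rho (z + w)| <= `|(1 + s) *: rho z| + `|rho (z + w) - (1 + s) *: rho z|.
      have := ler_normD ((1 + s) *: rho z) (rho (z + w) - (1 + s) *: rho z).
      by rewrite (addrC ((1 + s) *: rho z)) subrK.
    by rewrite normrZ (ger0_norm s1) [(1 + s) * _]mulrC => /le_trans; apply; rewrite lerD2l.
  have Y2 : Y <= 2 * d.
    have ds : d * (1 + s) <= d * (3 / 2).
      by rewrite ler_pM2l//; move: sle; rewrite ler_norml => /andP[]; lra.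
    have : L * tau ^+ 2 * d ^+ 2 <= d * (1 / 8).
      have -> : L * tau ^+ 2 * d ^+ 2 = d * (tau ^+ 2 * (L * d)) by ring.
      rewrite ler_pM2l//; have : tau ^+ 2 * (L * d) <= 1 * (L * d).
        rewrite ler_wpM2r ?mulr_ge0 ?(ltW d0)//.
        by rewrite expr2 -[leRHS]mulr1; apply: ler_pM; rewrite ?(ltW t0)//; lra.
      by rewrite mul1r; lra.
    rewrite /Y; move: ds; move: (d * (1 + s)) (L * _ * _) => *; lra.
  have incr : `|rho (z + w)| - B * `|rho (z + w)| ^+ 2 <= Y - B * Y ^+ 2.
    move: XY; set X := `|_| => XY; rewrite -subr_ge0.
    have -> : Y - B * Y ^+ 2 - (X - B * X ^+ 2) = (Y - X) * (1 - (B * X + B * Y)) by ring.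
    apply: mulr_ge0; first by rewrite subr_ge0.
    have : B * X <= B * (2 * d) by rewrite ler_pM2l//; exact: le_trans Y2.
    have : B * Y <= B * (2 * d) by rewrite ler_pM2l.
    by move: Bd; rewrite mulrCA -mulrA; move: (B * d) (B * X) (B * Y) => *; lra.
  apply: le_trans incr _; rewrite lerD2l lerN2 ler_pM2l//.
  have a0 : 0 <= d * (1 + s) by rewrite mulr_ge0// ltW.
  have Lt : 0 <= L * tau ^+ 2 * d ^+ 2.
    exact: (mulr_ge0 (mulr_ge0 L0 (sqr_ge0 _)) (sqr_ge0 _)).
  by rewrite lerXn2r ?nnegrE ?lerDl// addr_ge0.
move=> al be ab w.
have wE : w = (tau * al) *: v + (tau * be) *: mulJ v.
  by rewrite /w /turn [mulJ (_ *: _)]linearZ !scalerA ![tau * _]mulrC.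
have tab : (tau * al) ^+ 2 + (tau * be) ^+ 2 = tau ^+ 2.
  by rewrite !exprMn -mulrDr ab mulr1.
have [wr P1] := pt _ _ tab.
have NwE : - w = (- (tau * al)) *: v + (- (tau * be)) *: mulJ v.
  by rewrite wE !scaleNr opprD.
have JwE : mulJ w = (- (tau * be)) *: v + (tau * al) *: mulJ v.
  by rewrite wE -/(turn v (tau * al) (tau * be)) mulJ_turn.
have NJwE : - mulJ w = (tau * be) *: v + (- (tau * al)) *: mulJ v.
  by rewrite JwE opprD !scaleNr opprK.
have [_ P2] : _ := pt (- (tau * al)) (- (tau * be)) (etrans (congr2 +%R (sqrrN _) (sqrrN _)) tab).
have [_ P3] : _ := pt (- (tau * be)) (tau * al)
  (etrans (congr1 (+%R^~ _) (sqrrN _)) (etrans (addrC _ _) tab)).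
have [_ P4] : _ := pt (tau * be) (- (tau * al))
  (etrans (congr1 (+%R _) (sqrrN _)) (etrans (addrC _ _) tab)).
rewrite -wE in wr P1; rewrite -NwE in P2; rewrite -JwE in P3; rewrite -NJwE in P4.
split; first exact: wr.
have q1 : sqnorm w <= tau ^+ 2 * (C2 * d ^+ 2).
  rewrite /w sqnorm_turn ab mul1r sqnormZ ler_wpM2l ?sqr_ge0//.
  apply: le_trans (sqnorm_le _) _; rewrite /C2 -mulrA ler_wpM2l//.
  by rewrite -exprMn lerXn2r ?nnegrE// mulr_ge0// ltW.
have sq4 : sqnorm (z + w - p) + sqnorm (z - w - p) + sqnorm (z + mulJ w - p)
    + sqnorm (z - mulJ w - p) = 4 * sqnorm (z - p) + 4 * sqnorm w.
  have par (x y : Cspace R n) :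
      sqnorm (x + y - p) + sqnorm (x - y - p) = 2 * sqnorm (x - p) + 2 * sqnorm y.
    have -> : x + y - p = (x - p) + y by rewrite addrAC.
    have -> : x - y - p = (x - p) + - y by rewrite addrAC.
    by rewrite (sqnormD (x - p) y) (sqnormD (x - p) (- y)) sqnormN dotrNr; ring.
  by rewrite par -[LHS]addrA par sqnorm_mulJ; ring.
have td : 0 <= tau ^+ 2 * d ^+ 2 by rewrite mulr_ge0// sqr_ge0.
have LBt : (2 * L + 2 * C2 + 1) * (tau ^+ 2 * d ^+ 2) <= B * (tau ^+ 2 * d ^+ 2).
  by rewrite ler_wpM2r.
have LBt' : 2 * (L * tau ^+ 2 * d ^+ 2) + 2 * (tau ^+ 2 * (C2 * d ^+ 2))
    + tau ^+ 2 * d ^+ 2 <= B * (tau ^+ 2 * d ^+ 2).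
  by apply: le_trans LBt; rewrite le_eqVlt; apply/orP; left; apply/eqP; ring.
have goal_of (x1 x2 x3 x4 q : R) : x1 + x2 + x3 + x4
    <= 4 * d - 4 * (B * d ^+ 2) + 4 * (L * tau ^+ 2 * d ^+ 2)
       - 2 * (B * (tau ^+ 2 * d ^+ 2)) ->
    x1 + x2 + x3 + x4 + (4 * q + 4 * sqnorm w)
    <= 4 * (d - B * d ^+ 2 + q) - 2 * (tau ^+ 2 * d ^+ 2).
  move: q1 LBt'; move: (sqnorm w) (tau ^+ 2 * (_ * _)) (L * _ * _) (B * (_ * _)).
  by move: (tau ^+ 2 * _) (B * _); clear=> *; lra.
set S := (X in X <= _).
have -> : S = (`|rho (z + w)| - B * `|rho (z + w)| ^+ 2) +
    (`|rho (z - w)| - B * `|rho (z - w)| ^+ 2) +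
    (`|rho (z + mulJ w)| - B * `|rho (z + mulJ w)| ^+ 2) +
    (`|rho (z - mulJ w)| - B * `|rho (z - mulJ w)| ^+ 2) +
    (4 * sqnorm (z - p) + 4 * sqnorm w).
  by rewrite -sq4 /S; ring.
apply: goal_of; apply: le_trans (lerD (lerD (lerD P1 P2) P3) P4) _.
by rewrite le_eqVlt; apply/orP; left; apply/eqP; rewrite -tab; ring.
Qed.

End barrier.

(** * Estimates near a point of the submanifold *)

Section local_estimate.
Context (R : realType) (n m : nat) (M : set (Cspace R n)).
Implicit Types (p z w v : Cspace R n) (u : Cspace R n -> \bar R).
Context (subM : Ck_submanifold 2 m M) (genM : is_generic M).
Local Notation N := (n + n)%N.

Lemma compact_norm_ball p (r : R) : compact [set w | `|w - p| <= r].
Proof.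
apply: bounded_closed_compact.
  exists (`|p| + r); split; first exact: num_real.
  move=> a ar w /= wr.
  have := ler_normD p (w - p); rewrite (addrC p) subrK => /le_trans; apply.
  by apply: le_trans (ltW ar); rewrite lerD2l.
have -> : [set w | `|w - p| <= r] = (fun w => `|w - p|) @^-1` [set x | x <= r] by [].
apply: closed_comp; last exact: closed_le.
move=> w _; apply: (@continuous_comp _ _ _ (fun w => w - p)); last exact: norm_continuous.
by apply: (@continuousB _ _ _ (fun w => w) (fun=> p)) => //; exact: cst_continuous.
Qed.

Lemma strict_supermeanZ (D : set (Cspace R n)) (psi : Cspace R n -> R) (la : R) z :
  0 < la -> strict_supermean D psi z -> strict_supermean D (fun w => la * psi w) z.
Proof.
move=> la0 [b [kappa [k0 H]]]; exists b, (la * kappa); split; first exact: mulr_gt0.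
move=> al be ab w; have [Dw sum] := H _ _ ab; split=> //.
by rewrite -!mulrDr mulrCA -mulrBr ler_pM2l.
Qed.

(** On the ball of radius [r] around [p] the barrier, scaled by [c / r ^+ 2],
    dominates [c] on the boundary sphere because of the squared distance, is
    nonnegative on [M], and is a strict supermean elsewhere.  It vanishes at [p]
    and is Lipschitz there. *)
Lemma le_linear_of_bounded p0 : M p0 ->
  exists r C : R, [/\ 0 < r, 0 < C & forall u (c : R), plurisubharmonic u ->
    (forall w, M w -> (u w <= 0)%E) -> 0 < c ->
    (forall z, `|z - p0| < 2 * r -> (u z <= c%:E)%E) ->
    forall p z, M p -> `|p - p0| < r / 2 -> `|z - p0| < r / 2 ->
    (u z <= (c * (C * `|z - p|))%:E)%E].
Proof.
move=> Mp0.
have [rho [r0 [L [[r0p L0] crho rhoM lip dir]]]] :=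
  local_defining_function subM genM Mp0.
pose B := 2 * L + 2 * (N%:R * L ^+ 2) + 1.
have NL0 : 0 <= N%:R * L ^+ 2 by rewrite mulr_ge0// sqr_ge0.
have B0 : 0 < B by rewrite /B; lra.
have BL0 : 0 <= 4 * B * L by rewrite !mulr_ge0// ltW.
have BL1 : 0 < 4 * B * L + 1 by lra.
pose r := Num.min (r0 / 4) (4 * B * L + 1)^-1.
have rp : 0 < r by rewrite lt_min divr_gt0//= invr_gt0.
have rr0 : r <= r0 / 4 by rewrite ge_min lexx.
have rB : 4 * B * L * r <= 1.
  apply: le_trans (_ : (4 * B * L + 1) * r <= 1).
    by rewrite ler_pM2r//; lra.
  by rewrite -ler_pdivlMl// mulr1 ge_min lexx orbT.
have C0 : 0 < (L + N%:R * r) / r ^+ 2 + 1.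
  by apply: ltr_wpDl => //; rewrite divr_ge0 ?sqr_ge0// addr_ge0// mulr_ge0// ltW.
exists r, ((L + N%:R * r) / r ^+ 2 + 1); split => //.
move=> u c pshu uM c0 uc p z Mp pp0 zp0.
have r2 : 0 < r ^+ 2 by rewrite exprn_gt0.
pose psi w := `|rho w| - B * `|rho w| ^+ 2 + sqnorm (w - p).
pose D := [set w | `|w - p| <= r].
have Dp0 w : D w -> `|w - p0| < 2 * r.
  rewrite /D /= => wp; have := ler_normD (w - p) (p - p0).
  rewrite addrA subrK; move: (`|w - p0|) (`|w - p|) wp (`|p - p0|) pp0 => *; lra.
have Dr0 w : D w -> `|w - p0| < r0 by move=> /Dp0; move: (`|_|) => *; lra.
have pr0 : `|p - p0| < r0 by apply: lt_le_trans pp0 _; lra.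
have rhop : rho p = 0 by apply/rhoM.
have rhoL w : D w -> `|rho w| <= L * `|w - p|.
  by move=> Dw; have := lip _ _ pr0 (Dr0 _ Dw); rewrite rhop subr0.
have rhoB w : D w -> 4 * B * `|rho w| <= 1.
  move=> Dw; apply: le_trans rB; rewrite -[leRHS]mulrA ler_wpM2l ?mulr_ge0 ?(ltW B0)//.
  by apply: le_trans (rhoL _ Dw) _; rewrite ler_wpM2l.
have rho_pos w : D w -> 0 <= `|rho w| - B * `|rho w| ^+ 2.
  move=> Dw; rewrite expr2 mulrA -[X in X - _]mul1r -mulrBl mulr_ge0// subr_ge0.
  have := rhoB _ Dw; have : 0 <= B * `|rho w| by rewrite mulr_ge0// ltW.
  by rewrite -mulrA; move: (B * _) => *; lra.
pose la := c / r ^+ 2.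
have la0 : 0 < la by rewrite divr_gt0.
have ucmp : forall w, D w -> (u w <= (la * psi w)%:E)%E.
  apply: (psh_comparison pshu (@compact_norm_ball p r)).
    move=> w Dw; have cr := crho _ (Dr0 _ Dw).
    have cn : {for w, continuous (fun y => `|rho y|)}.
      exact: (continuous_comp cr (@norm_continuous _ _ _)).
    have cq := @continuous_sqnormB R _ p w.
    have cl := @cst_continuous _ _ la w; have cB := @cst_continuous _ _ B w.
    have := continuousM cl (continuousD (continuousB cn (continuousM cB (continuousM cn cn))) cq).
    by [].
  move=> w Dw; have [rw0|rwn0] := eqVneq (rho w) 0.
    left; have Mw : M w by apply/(rhoM _ (Dr0 _ Dw)).
    apply: le_trans (uM _ Mw) _; rewrite lee_fin mulr_ge0 ?(ltW la0)//.
    by rewrite addr_ge0 ?sqnorm_ge0// rho_pos.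
  have [wr|wnr] := eqVneq (`|w - p|) r.
    left; apply: le_trans (uc _ (Dp0 _ Dw)) _; rewrite lee_fin.
    rewrite /la -mulrA ler_peMr ?(ltW c0)// ler_pdivlMl// mulr1.
    rewrite -[leLHS]add0r lerD ?rho_pos//.
    by rewrite -[in leLHS]wr norm_sqr_le_sqnorm.
  right; apply: strict_supermeanZ => //.
  have [v vL est] := dir _ (Dr0 _ Dw).
  apply: (barrier_supermean (L := L) (v := v)) => //.
  - by rewrite normr_gt0.
  - exact: rhoB.
  - by rewrite lt_neqAle wnr.
  - by move=> s t v' wr; apply: est; apply: Dr0.
have Dz : D z.
  rewrite /D /=; have := ler_distD p0 z p; rewrite (distrC p0).
  move: (`|z - p|) (`|z - p0|) zp0 (`|p - p0|) pp0 => *; lra.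
apply: le_trans (ucmp _ Dz) _; rewrite lee_fin /la -mulrA ler_pM2l//.
rewrite ler_pdivrMl// mulrA mulrDr mulrCA mulfV ?gt_eqF// !mulr1.
have zp : 0 <= `|z - p| by [].
have : `|rho z| - B * `|rho z| ^+ 2 <= L * `|z - p|.
  apply: le_trans (rhoL _ Dz); rewrite gerBl mulr_ge0 ?sqr_ge0//; exact: ltW.
have : sqnorm (z - p) <= N%:R * r * `|z - p|.
  apply: le_trans (sqnorm_le _) _; rewrite -mulrA ler_wpM2l// expr2.
  by rewrite ler_wpM2r.
have : 0 <= r ^+ 2 * `|z - p| by rewrite mulr_ge0// ltW.
rewrite /psi !mulrDl; move: (L * _) (N%:R * r * _) (r ^+ 2 * _) (sqnorm _) => *; lra.
Qed.

Lemma lelong_locally_bounded u p0 (r : R) : lelong u -> 0 < r ->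
  exists2 c : R, 0 < c & forall z, `|z - p0| < r -> (u z <= c%:E)%E.
Proof.
move=> /lelong_growth[C uC] r0.
pose q := 2 * sqnorm p0 + 2 * (N%:R * r ^+ 2).
have q0 : 0 <= q by rewrite addr_ge0// mulr_ge0 ?sqnorm_ge0// mulr_ge0// sqr_ge0.
have l0 : 0 <= ln (1 + q) by rewrite ln_ge0// lerDl.
exists (`|C| + ln (1 + q) / 2 + 1).
  by rewrite ltr_wpDl// addr_ge0// divr_ge0.
move=> z zr; apply: le_trans (uC z) _; rewrite lee_fin.
have : ln (1 + sqnorm z) <= ln (1 + q).
  have z0 := sqnorm_ge0 z.
  rewrite ler_ln ?posrE; [|by lra|by lra].
  rewrite lerD2l; apply: le_trans (sqnorm_le2 z p0) _; rewrite lerD2l ler_wpM2l//.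
  apply: le_trans (sqnorm_le _) _; rewrite ler_wpM2l// lerXn2r ?nnegrE ?(ltW r0)//.
  exact: ltW.
have := ler_norm C; move: (ln _) (ln _) => *; lra.
Qed.

Lemma le_of_halving (P : R -> Prop) (c b : R) : 0 <= b ->
  P c -> (forall x, P x -> P (x / 2 + b)) ->
  exists2 x, P x & x <= 2 * b + 1.
Proof.
move=> b0 Pc Phalf.
have iter k : exists2 x, P x & x <= `|c| / 2 ^+ k + 2 * b.
  elim: k => [|k [x Px xk]].
    exists c => //; rewrite expr0 divr1; have := ler_norm c; lra.
  exists (x / 2 + b); first exact: Phalf.
  have -> : `|c| / 2 ^+ k.+1 = (`|c| / 2 ^+ k) / 2.
    by rewrite exprSr invfM mulrA.
  lra.
have [x Px xk] := iter (Num.bound `|c|).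
exists x => //; apply: le_trans xk _; rewrite addrC lerD2l.
rewrite ler_pdivrMr ?exprn_gt0// mul1r -natrX.
apply: le_trans (ltW (archi_boundP (normr_ge0 c))) _.
by rewrite ler_nat ltnW// ltn_expl.
Qed.

(** [le_linear_of_bounded] bounds [u] by a multiple of its supremum on a ball,
    which still depends on [u].  If [u <= c] there, then [u <= c / 2] on a small
    ball of radius [s], and the Bernstein-Walsh inequality propagates this to
    [u <= c / 2 + b] on the large ball, with [b] independent of [u].  Iterating
    brings every [u] below [2 * b + 1]. *)
Lemma uniform_local_estimate p0 : M p0 ->
  exists r A : R, [/\ 0 < r, 0 < A & forall u, lelong u ->
    (forall w, M w -> (u w <= 0)%E) ->
    forall p z, M p -> `|p - p0| < r -> `|z - p0| < r ->
    (u z <= (A * `|z - p|)%:E)%E].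
Proof.
move=> Mp0; have [r [C [r0 C0 est]]] := le_linear_of_bounded Mp0.
pose s := Num.min (r / 4) (C * 2)^-1.
have s0 : 0 < s by rewrite lt_min divr_gt0//= invr_gt0 mulr_gt0.
have sr : s <= r / 4 by rewrite ge_min lexx.
have sC : C * s <= 1 / 2.
  have : C * 2 * s <= 1 by rewrite -ler_pdivlMl ?mulr_gt0// mulr1 ge_min lexx orbT.
  by rewrite mulrAC; lra.
pose q := N%:R * (2 * r) ^+ 2 / s ^+ 2.
have q0 : 0 <= q by rewrite divr_ge0 ?sqr_ge0// mulr_ge0// sqr_ge0.
pose b := ln (1 + q) + 1.
have b1 : 1 <= b by rewrite lerDr ln_ge0// lerDl.
exists (r / 2), ((2 * b + 1) * C); split.
- by rewrite divr_gt0.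
- by rewrite mulr_gt0//; lra.
move=> u lu uM; have [pshu _] := lu.
pose P c := 0 < c /\ forall z, `|z - p0| < 2 * r -> (u z <= c%:E)%E.
have Phalf c : P c -> P (c / 2 + b).
  move=> [c0 uc]; split; first by lra.
  move=> z zr.
  have small w : sqnorm (w - p0) <= s ^+ 2 -> (u w <= (c / 2)%:E)%E.
    move=> ws; have wp : `|w - p0| <= s.
      rewrite -(@ler_pXn2r _ 2)// ?nnegrE ?(ltW s0)//.
      exact: le_trans (norm_sqr_le_sqnorm _) ws.
    apply: le_trans (est u c pshu uM c0 uc p0 w Mp0 _ _) _.
    - by rewrite subrr normr0 divr_gt0.
    - by apply: le_lt_trans wp _; lra.
    rewrite lee_fin ler_pM2l//; apply: le_trans (_ : C * s <= _).
      by rewrite ler_pM2l.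
    by rewrite -[leRHS]mul1r.
  have [zs|zs] := leP (sqnorm (z - p0)) (s ^+ 2).
    by apply: le_trans (small _ zs) _; rewrite lee_fin lerDl; lra.
  apply: le_trans (bernstein_walsh lu s0 small (ltW zs)) _.
  rewrite lee_fin lerD2l; apply: le_trans (_ : ln (1 + q) <= _); last by rewrite lerDl.
  have s2 : 0 < s ^+ 2 by rewrite exprn_gt0.
  have zq : sqnorm (z - p0) / s ^+ 2 <= q.
    rewrite ler_pM2r ?invr_gt0//; apply: le_trans (sqnorm_le _) _.
    rewrite ler_wpM2l// lerXn2r ?nnegrE ?(ltW zr)//.
    by rewrite mulr_ge0// ltW.
  rewrite ler_ln ?posrE; [by lra| |by lra].
  by rewrite divr_gt0//; apply: lt_trans zs.
have [c1 c10 uc1] := @lelong_locally_bounded u p0 (2 * r) lu (mulr_gt0 (ltr0n _ 2) r0).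
have [] := @le_of_halving P c1 b _ (conj c10 uc1) Phalf; first by lra.
move=> c [c0 uc] cb p z Mp pp0 zp0.
apply: le_trans (est u c pshu uM c0 uc p z Mp pp0 zp0) _.
by rewrite lee_fin mulrA ler_wpM2r// ler_pM2r.
Qed.

End local_estimate.

(** * From points to compact sets *)

Section assembly.
Context (R : realType) (n m : nat) (M : set (Cspace R n)).
Implicit Types (p z w v : Cspace R n) (u : Cspace R n -> \bar R).
Context (subM : Ck_submanifold 2 m M) (genM : is_generic M).

(** For [p] close to a centre [z] the local estimate applies to [p]; for the other
    points [p] of [K], [y] is nearer to [z] than to [p], and the estimate at [z]
    is enough. *)
Lemma green_le_linear (K : set (Cspace R n)) : compact K -> K `<=` M ->
  exists2 A : R, 0 < A & forall z, K z ->
    \forall y \near z, forall p, K p -> (green M y <= (A * `|y - p|)%:E)%E.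
Proof.
move=> /compact_near_coveringP cK KM.
pose good (A : R) : set (Cspace R n) :=
  [set y | forall p, K p -> (green M y <= (A * `|y - p|)%:E)%E].
suff : \forall A \near +oo, K `<=` (fun z => nbhs z (good A)).
  move=> H; near (+oo : set_system R) => A.
  exists A; first by near: A; apply: nbhs_pinfty_gt; exact: num_real.
  by near: A; exact: H.
apply: cK => z Kz.
have [r [A0 [r0 A00 est]]] := uniform_local_estimate subM genM (KM _ Kz).
exists (ball z (r / 2), [set A | A0 <= A]) => /=.
  split; first by apply: nbhsx_ballx; rewrite divr_gt0.
  by apply: nbhs_pinfty_ge; exact: num_real.
move=> [z' A] /= [zz' AA].
have : nbhs z' (ball z (r / 2)).
  by apply: open_nbhs_nbhs; split => //; exact: ball_open.
apply: filterS => y; rewrite -ball_normE /= distrC => yz p Kp.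
have yr : `|y - z| < r by apply: lt_trans yz _; lra.
apply: ge_ereal_sup => _ [u [lu uM] <-].
have A0le (c d : R) : 0 <= c -> c <= d -> (u y <= (A0 * c)%:E)%E ->
    (u y <= (A * d)%:E)%E.
  move=> c0 cd /le_trans; apply; rewrite lee_fin.
  by apply: ler_pM => //; exact: ltW.
have [pz|pz] := ltP (`|p - z|) r.
  apply: (A0le `|y - p|) => //.
  by apply: est => //; exact: KM.
apply: (A0le `|y - z|) => //.
  have := ler_distD y p z; rewrite (distrC p y).
  move: (`|p - z|) pz (`|y - z|) yz (`|y - p|) => *; lra.
apply: est => //; first exact: KM.
by rewrite subrr normr0.
Unshelve. all: by end_near. Qed.

Lemma usc_reg_le_linear (f : Cspace R n -> \bar R) (A : R) z p : 0 < A ->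
  (\forall y \near z, (f y <= (A * `|y - p|)%:E)%E) ->
  (usc_reg f z <= (A * `|z - p|)%:E)%E.
Proof.
move=> A0 fA; apply/lee_addgt0Pr => e e0.
have eA : 0 < e / A by rewrite divr_gt0.
have near2 : \forall y \near z, (f y <= (A * `|z - p|)%:E + e%:E)%E.
  have near1 : \forall y \near z, `|y - z| < e / A.
    apply/nbhs_ballP; exists (e / A) => // y.
    by rewrite -ball_normE /= distrC.
  apply: (@filterS _ (nbhs z) _ _ _ _ (filterI fA near1)) => y [fy yz].
  apply: le_trans fy _; rewrite -EFinD lee_fin.
  have -> : A * `|z - p| + e = A * (`|z - p| + e / A).
    by rewrite mulrDr mulrCA mulfV ?gt_eqF// mulr1.
  rewrite ler_pM2l//; apply: le_trans (ler_distD z y p) _.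
  by rewrite addrC lerD2l ltW.
pose W := [set y | (f y <= (A * `|z - p|)%:E + e%:E)%E].
apply: (@le_trans _ _ (ereal_sup (f @` W))).
  by apply: ereal_inf_lbound; exists W.
by apply: ge_ereal_sup => _ [y fy <-].
Qed.

End assembly.

(** * Lipschitz regularity of the Green function *)

Theorem theorem5p1 (R : realType) (n m : nat) (M : set (Cspace R n))
    (M_submanifold : Ck_submanifold 2 m M) (M_generic : is_generic M) :
  Lambda_pluriregular 1 M.
Proof.
move=> K cK KM.
have [K0|/set0P[p0 Kp0]] := eqVneq K set0.
  by exists 1, set0; split=> //; rewrite K0.
have [A A0 est] := green_le_linear M_submanifold M_generic cK KM.
pose good : set (Cspace R n) :=
  [set y | forall p, K p -> (green M y <= (A * `|y - p|)%:E)%E].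
exists A, (interior good); split => //; first exact: open_interior.
move=> z goodz.
have usc p : K p -> (usc_reg (green M) z <= (A * eucl_norm (z - p))%:E)%E.
  move=> Kp; apply: le_trans (_ : _ <= (A * `|z - p|)%:E)%E _.
    apply: usc_reg_le_linear => //; move: goodz; apply: filterS => y; exact.
  by rewrite lee_fin ler_pM2l// norm_le_eucl_norm.
have dist0 : 0 <= eucl_dist z K.
  apply: lb_le_inf; first by exists (eucl_norm (z - p0)), p0.
  by move=> _ [p _ <-]; exact: sqrtr_ge0.
rewrite powRr1//; move: (usc); case: (usc_reg _ _) => [x||] usc'.
- rewrite lee_fin -ler_pdivrMl//.
  apply: lb_le_inf; first by exists (eucl_norm (z - p0)), p0.
  by move=> _ [p Kp <-]; rewrite ler_pdivrMl// -lee_fin; exact: usc'.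
- by have := usc' _ Kp0; rewrite leNgt ltry.
- exact: leNye.
Qed.
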